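(* Let $\Omega\subset\mathbb{R}^n$ and let $u:\Omega\to\mathbb{R}$ be a smooth and convex subsolution of $$\Delta^2u-F(x,u,\nabla u,\nabla^2u,\nabla^3u)=0,\qquad\text{with }F\ge0,$$ that is, $\Delta^2u\ge F(x,u,\nabla u,\nabla^2u,\nabla^3u)$ in $\Omega$. Then for any $B_R\subset\Omega$, any $0<r<R$ and any $p\ge1$, $$\sup_{B_r}(\Delta u)^2\le\frac{C}{(R-r)^{n/p}}\,\|\Delta u\|^2_{L^{2p}(B_R)},$$ where $C=C(n,p)$.
   Context: $F$ is a real valued function of the indicated arguments. $B_r$ and $B_R$ are concentric balls of radii $r$ and $R$; $\Delta^2$ is the bilaplacian. *)

(* Defs.v *)
From HB Require Import structures.
From mathcomp Require Import all_boot all_order all_algebra.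
From mathcomp Require Import all_classical all_reals all_analysis.

Set Implicit Arguments.
Unset Strict Implicit.
Unset Printing Implicit Defensive.

Import Order.TTheory GRing.Theory Num.Theory.
Import numFieldNormedType.Exports.

Local Open Scope classical_set_scope.
Local Open Scope ring_scope.

(* The sup-norm topology of ['rV[R]_n] is the Euclidean one, but the balls of
   the statement are round, so the library's [ball] is not used for them. *)
Definition enorm (R : realType) (n : nat) (x : 'rV[R]_n) : R :=
  Num.sqrt (\sum_(i < n) x 0 i ^+ 2).

Definition eball (R : realType) (n : nat) (c : 'rV[R]_n) (r : R) :
    set 'rV[R]_n :=
  [set x | enorm (x - c) < r].

(* Product sigma-algebra: the smallest one that makes every coordinate
   Borel measurable. *)
Definition rV_display : measure_display. Proof. exact. Qed.

Section measurable_rV.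
Variables (R : realType) (n : nat).

Definition rV_coord (i : 'I_n) (x : 'rV[R]_n) : measurableTypeR R := x 0 i.

HB.instance Definition _ := @isMeasurable.Build rV_display 'rV[R]_n
  (g_sigma_preimage rV_coord) (@sigma_algebra0 _ _ _)
  (@sigma_algebraC _ _) (@sigma_algebra_bigcup _ _ _).

Lemma measurable_rV_coord i : measurable_fun [set: 'rV[R]_n] (rV_coord i).
Proof.
move=> _ Y mY; rewrite setTI; apply: sub_sigma_algebra => /=.
rewrite -bigcup_seq/=; exists i => /=; first by rewrite mem_index_enum.
by exists Y => //; rewrite setTI.
Qed.

Lemma measurable_fun_rVP d (T : measurableType d) (f : T -> 'rV[R]_n) :
  (forall i, measurable_fun [set: T] (rV_coord i \o f)) ->
  measurable_fun [set: T] f.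
Proof.
move=> mf _ Y mY; rewrite setTI.
suff: g_sigma_preimage rV_coord `<=` [set B | measurable (f @^-1` B)] by exact.
apply: smallest_sub.
  split => /=.
  - by rewrite preimage_set0.
  - by move=> A mA; rewrite setTD preimage_setC; exact: measurableC.
  - by move=> F mF; rewrite preimage_bigcup; exact: bigcup_measurable.
move=> A; rewrite -bigcup_seq => -[i _ [B mB <-]] /=.
by rewrite setTI -comp_preimage -[X in measurable X]setTI; exact: mf.
Qed.

End measurable_rV.

Section lebesgue_rV_step.
Variables (R : realType) (n : nat).
Variable m : {sigma_finite_measure set 'rV[R]_n -> \bar R}.

Definition rV_cons (p : measurableTypeR R * 'rV[R]_n) : 'rV[R]_n.+1 :=
  row_mx (p.1 : R)%:M p.2.

Lemma rV_cons0 p : rV_cons p 0 ord0 = p.1.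
Proof.
have -> : ord0 = lshift n (ord0 : 'I_1) by exact/val_inj.
by rewrite /rV_cons (@row_mxEl _ 1 1 n) mxE eqxx mulr1n.
Qed.

Lemma rV_consS p i : rV_cons p 0 (lift ord0 i) = p.2 0 i.
Proof.
have -> : lift ord0 i = rshift 1 i by exact/val_inj.
by rewrite /rV_cons (@row_mxEr _ 1 1 n).
Qed.

Lemma measurable_rV_cons : measurable_fun [set: _] rV_cons.
Proof.
apply: measurable_fun_rVP => i.
case: (unliftP ord0 i) => [j ->|->].
  rewrite (_ : _ \o _ = @rV_coord R n j \o snd).
    by apply: measurableT_comp => //; exact: measurable_rV_coord.
  by apply/funext => p; rewrite /= /rV_coord rV_consS.
rewrite (_ : _ \o _ = fst) //.
by apply/funext => p; rewrite /= /rV_coord rV_cons0.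
Qed.

Definition lebesgue_rV_next : set 'rV[R]_n.+1 -> \bar R :=
  pushforward (lebesgue_measure \x m)%E rV_cons.

Let preimage_rV_cons A : measurable A -> measurable (rV_cons @^-1` A).
Proof.
by move=> mA; rewrite -[X in measurable X]setTI; exact: measurable_rV_cons.
Qed.

Let next0 : lebesgue_rV_next set0 = 0%E.
Proof. by rewrite /lebesgue_rV_next /pushforward preimage_set0 measure0. Qed.

Let next_ge0 A : (0 <= lebesgue_rV_next A)%E.
Proof. by rewrite /lebesgue_rV_next /pushforward measure_ge0. Qed.

Let next_sigma_additive : semi_sigma_additive lebesgue_rV_next.
Proof.
move=> F mF tF mUF; rewrite /lebesgue_rV_next /pushforward preimage_bigcup.
apply: measure_semi_sigma_additive.
- by move=> k; exact: preimage_rV_cons.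
- apply/trivIsetP => /= i j _ _ ij; rewrite -preimage_setI.
  by move/trivIsetP : tF => /(_ _ _ _ _ ij) ->//; rewrite preimage_set0.
- by rewrite -preimage_bigcup; exact: preimage_rV_cons.
Qed.

HB.instance Definition _ := isMeasure.Build _ _ _ lebesgue_rV_next
  next0 next_ge0 next_sigma_additive.

Let next_sigma_finite : sigma_finite setT lebesgue_rV_next.
Proof.
pose g (x : 'rV[R]_n.+1) : measurableTypeR R * 'rV[R]_n :=
  (x 0 ord0, \row_i x 0 (lift ord0 i)).
have mg : measurable_fun [set: _] g.
  apply: measurable_fun_pair; first exact: (@measurable_rV_coord R n.+1 ord0).
  apply: measurable_fun_rVP => i.
  rewrite (_ : _ \o _ = @rV_coord R n.+1 (lift ord0 i)).
    exact: measurable_rV_coord.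
  by apply/funext => x; rewrite /= /rV_coord mxE.
have gK p : g (rV_cons p) = p.
  case: p => a v; rewrite /g rV_cons0; congr pair.
  by apply/rowP => j; rewrite mxE rV_consS.
have /sigma_finiteP[A [AT ndA Aoo]] :=
  sigma_finiteT (@lebesgue_measure R : {sigma_finite_measure set _ -> \bar R}).
have /sigma_finiteP[B [BT ndB Boo]] := sigma_finiteT m.
exists (fun k => g @^-1` (A k `*` B k)).
  apply/esym; rewrite -subTset => x _.
  have [i _ Ai] : (\bigcup_i A i) (g x).1 by rewrite -AT.
  have [j _ Bj] : (\bigcup_i B i) (g x).2 by rewrite -BT.
  exists (maxn i j) => //; split.
    by move: (Ai); exact/subsetPset/ndA/leq_maxl.
  by move: (Bj); exact/subsetPset/ndB/leq_maxr.
move=> k; have [mA Ak] := Aoo k; have [mB Bk] := Boo k.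
have mAB : measurable (A k `*` B k) by exact: measurableX.
split; first by rewrite -[X in measurable X]setTI; exact: mg.
rewrite /lebesgue_rV_next /pushforward -comp_preimage.
rewrite (_ : g \o rV_cons = id); last exact/funext.
by rewrite product_measure1E// lte_mul_pinfty// ge0_fin_numE.
Qed.

HB.instance Definition _ := Measure_isSigmaFinite.Build _ _ _ lebesgue_rV_next
  next_sigma_finite.

End lebesgue_rV_step.

(* n-dimensional Lebesgue measure: the n-fold product of the Lebesgue measure
   of the line, transported to row vectors. *)
Fixpoint lebesgue_rV (R : realType) (n : nat) :
    {sigma_finite_measure set 'rV[R]_n -> \bar R} :=
  match n with
  | 0%N => \d_(0 : 'rV[R]_0)
  | n'.+1 => lebesgue_rV_next (lebesgue_rV R n')
  end.

Lemma measurable_rV_box (R : realType) (n : nat)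
    (A : 'I_n -> set (measurableTypeR R)) :
  (forall i, measurable (A i)) ->
  measurable [set x : 'rV[R]_n | forall i, A i (x 0 i)].
Proof.
move=> mA.
rewrite (_ : [set _ | _] = \big[setI/setT]_(i < n) (@rV_coord R n i @^-1` A i)).
  apply: bigsetI_measurable => i _.
  by rewrite -[X in measurable X]setTI; exact: measurable_rV_coord.
rewrite -bigcap_seq; apply/seteqP; split => x /=; first by move=> + i _; exact.
by move=> + i; apply; rewrite /= mem_index_enum.
Qed.

Lemma lebesgue_rV_box (R : realType) (n : nat)
    (A : 'I_n -> set (measurableTypeR R)) :
  (forall i, measurable (A i)) ->
  lebesgue_rV R n [set x | forall i, A i (x 0 i)] =
  (\prod_(i < n) lebesgue_measure (A i))%E.
Proof.
elim: n A => [A _|n IH A mA].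
  by rewrite big_ord0 /= diracE mem_set//= => -[].
rewrite big_ord_recl -(IH (fun i => A (lift ord0 i)))//= /lebesgue_rV_next.
rewrite /pushforward -product_measure1E//; last first.
  by apply: (@measurable_rV_box R n (fun i => A (lift ord0 i))) => i; exact: mA.
congr (_ _); apply/seteqP; split => -[a v] /=.
  move=> Av; split; first by have := Av ord0; rewrite rV_cons0.
  by move=> i; have := Av (lift ord0 i); rewrite rV_consS.
move=> [Aa Av] i; case: (unliftP ord0 i) => [j ->|->].
  by rewrite rV_consS.
by rewrite rV_cons0.
Qed.

Definition partial (R : realType) (n : nat) (i : 'I_n) (f : 'rV[R]_n -> R) :
    'rV[R]_n -> R :=
  fun x => 'D_(delta_mx 0 i) f x.

(* [partials [:: i; j; k] f] is the derivative of [f] with respect to the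
   k-th, then the j-th, then the i-th variable. *)
Definition partials (R : realType) (n : nat) (s : seq 'I_n)
    (f : 'rV[R]_n -> R) : 'rV[R]_n -> R :=
  foldr (@partial R n) f s.

Definition smooth_on (R : realType) (n : nat) (Omega : set 'rV[R]_n)
    (f : 'rV[R]_n -> R) : Prop :=
  forall (s : seq 'I_n) (x : 'rV[R]_n), Omega x ->
    {for x, continuous (partials s f)} /\
    (forall i : 'I_n, derivable (partials s f) x (delta_mx 0 i)).

(* When [Omega] is convex this amounts to [convex_function Omega f]; otherwise
   the convexity inequality is required only along segments of [Omega]. *)
Definition convex_on (R : realType) (n : nat) (Omega : set 'rV[R]_n)
    (f : 'rV[R]_n -> R) : Prop :=
  forall K : set 'rV[R]_n, @convex_set R 'rV[R]_n K -> K `<=` Omega ->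
    @convex_function R 'rV[R]_n K f.

Definition gradient (R : realType) (n : nat) (f : 'rV[R]_n -> R)
    (x : 'rV[R]_n) : 'rV[R]_n :=
  \row_i partial i f x.

Definition hessian (R : realType) (n : nat) (f : 'rV[R]_n -> R)
    (x : 'rV[R]_n) : 'M[R]_n :=
  \matrix_(i, j) partials [:: i; j] f x.

Definition third_derivative (R : realType) (n : nat) (f : 'rV[R]_n -> R)
    (x : 'rV[R]_n) : 'I_n -> 'I_n -> 'I_n -> R :=
  fun i j k => partials [:: i; j; k] f x.

Definition laplacian (R : realType) (n : nat) (f : 'rV[R]_n -> R) :
    'rV[R]_n -> R :=
  fun x => \sum_(i < n) partials [:: i; i] f x.

Definition bilaplacian (R : realType) (n : nat) (f : 'rV[R]_n -> R) :
    'rV[R]_n -> R :=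
  laplacian (laplacian f).

Definition LnormOn (R : realType) (n : nat) (q : R) (D : set 'rV[R]_n)
    (f : 'rV[R]_n -> R) : \bar R :=
  ('N[lebesgue_rV R n]_(q%:E)[(EFin \o f) \_ D])%E.

(* Main.v *)
Require Import Defs.
From mathcomp Require Import all_boot all_order all_algebra.
From mathcomp Require Import all_classical all_reals all_analysis.
From mathcomp Require Import measurable_realfun ring lra.
Import Order.TTheory GRing.Theory Num.Theory.
Import numFieldNormedType.Exports.
Local Open Scope classical_set_scope.
Local Open Scope ring_scope.
Set Implicit Arguments.
Unset Strict Implicit.

(** Let [w] be the Laplacian of [u]. Since [u] is convex, its pure second
    derivatives are nonnegative, so [w >= 0] ([convex_on_laplacian_ge0]); since
    [F >= 0], the differential inequality says that [w] is subharmonic. The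
    theorem is thus the local bound of a nonnegative subharmonic function by its
    L^q norm, with [q = 2 * p], and both sides are squared at the end.

    The bound comes from a mean-value inequality with a weight. For the kernel
    phi(y) = max(0, 1 - |y|^2), the field y phi(y) is minus the gradient of
    phi^2 / 4. Hence the weighted averages

      g(t) = int phi(y) w(x + t y) dy

    satisfy, after differentiation under the integral sign and integration by
    parts,

      g'(t) = int phi(y) (y . grad w(x + t y)) dy
            = t int (phi(y)^2 / 4) (Laplacian of w)(x + t y) dy >= 0,

    so that w(x) int phi = g(0) <= g(d) ([bump_avg_le]). As the constant of the
    theorem may be any function of [n] and [p], a continuous radial weight
    serves as well as the indicator of the ball, and the integration by parts can
    be done one coordinate at a time on a cube containing the support of the
    kernel, by Fubini and the fundamental theorem of calculus
    ([integral_cube_partial]).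

    For x in the ball of radius [r] take d = [rho - r], so that x + d y stays in
    the ball of radius [rho]. Hoelder's inequality bounds g(d) by the norm of phi
    in the conjugate exponent times the L^q norm of y |-> w(x + d y), and the
    change of variables z = x + d y ([ge0_integral_rV_affine]) produces the
    factor d^(-n/q) ([subharmonic_Lnorm_bound]). Squaring gives d^(-n/p) and the
    constant (|phi|_q' / int phi)^2. *)

(** * Continuity and the Euclidean norm *)

Section pointwise_continuity.
Context {R : realType} {T : topologicalType}.
Implicit Types (f g : T -> R) (x : T).

Lemma continuous_atB f g x : {for x, continuous f} -> {for x, continuous g} ->
  {for x, continuous (fun y => f y - g y)}.
Proof. exact: (@cvgB R R^o T (nbhs x)). Qed.

Lemma continuous_atM f g x : {for x, continuous f} -> {for x, continuous g} ->
  {for x, continuous (fun y => f y * g y)}.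
Proof. exact: (@cvgM R T (nbhs x)). Qed.

Lemma continuous_atX f k x : {for x, continuous f} ->
  {for x, continuous (fun y => f y ^+ k)}.
Proof.
move=> cf; apply: (@continuous_comp _ _ _ f (fun a => a ^+ k) x cf).
exact: exprn_continuous.
Qed.

Lemma continuous_at_sum n (f : 'I_n -> T -> R) x :
  (forall i, {for x, continuous (f i)}) ->
  {for x, continuous (fun y => \sum_(i < n) f i y)}.
Proof.
move=> cf; apply: (@cvg_big R 'I_n +%R 0 xpredT _ T (nbhs x)) => [|i _].
  exact: add_continuous.
exact: cf.
Qed.

End pointwise_continuity.

Section euclidean_norm.
Context {R : realType} {n : nat}.
Implicit Types (x y : 'rV[R]_n) (i : 'I_n).

Lemma enorm_ge0 x : 0 <= enorm x.
Proof. exact: sqrtr_ge0. Qed.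

Lemma sqr_enorm x : enorm x ^+ 2 = \sum_(i < n) x 0 i ^+ 2.
Proof. by rewrite sqr_sqrtr// sumr_ge0// => i _; exact: sqr_ge0. Qed.

Lemma cauchy_schwarz x y :
  (\sum_(i < n) x 0 i * y 0 i) ^+ 2 <= enorm x ^+ 2 * enorm y ^+ 2.
Proof.
(* With [P] the inner product and [X], [Y] the squared norms, the squared norm
   of [Y x - P y] is [Y (X Y - P ^+ 2)]. *)
rewrite !sqr_enorm; set X := \sum_i x 0 i ^+ 2; set Y := \sum_i y 0 i ^+ 2.
set P := \sum_i _.
have Y0 : 0 <= Y by rewrite sumr_ge0// => i _; exact: sqr_ge0.
have key : 0 <= Y * (X * Y - P ^+ 2).
  have -> : Y * (X * Y - P ^+ 2) = \sum_i (Y * x 0 i - P * y 0 i) ^+ 2.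
    transitivity (\sum_i (Y ^+ 2 * x 0 i ^+ 2 - 2 * Y * P * (x 0 i * y 0 i)
                          + P ^+ 2 * y 0 i ^+ 2)).
      rewrite big_split/= big_split/= sumrN -!mulr_sumr -/X -/Y -/P; ring.
    by apply: eq_bigr => i _; ring.
  by rewrite sumr_ge0// => i _; exact: sqr_ge0.
have [Y00|YN0] := eqVneq Y 0; last first.
  have Y_gt0 : 0 < Y by rewrite lt_neqAle eq_sym YN0.
  by rewrite -subr_ge0 -(pmulr_rge0 _ Y_gt0).
have y0 i : y 0 i = 0.
  apply/eqP; rewrite -sqrf_eq0; move/eqP: Y00; rewrite psumr_eq0.
    by move=> /allP/(_ i); rewrite mem_index_enum => /(_ isT).
  by move=> j _; exact: sqr_ge0.
by rewrite /P big1 ?expr0n ?Y00 ?mulr0// => i _; rewrite y0 mulr0.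
Qed.

Lemma enormD x y : enorm (x + y) <= enorm x + enorm y.
Proof.
rewrite -(@ler_pXn2r _ 2) ?nnegrE ?addr_ge0 ?enorm_ge0// sqrrD.
have -> : enorm (x + y) ^+ 2 =
    enorm x ^+ 2 + (\sum_(i < n) x 0 i * y 0 i) *+ 2 + enorm y ^+ 2.
  rewrite !sqr_enorm -sumrMnl -!big_split/=.
  by apply: eq_bigr => i _; rewrite mxE sqrrD.
rewrite lerD2r lerD2l lerMn2r/=.
apply: (le_trans (ler_norm _)).
rewrite -(@ler_pXn2r _ 2) ?nnegrE ?mulr_ge0 ?enorm_ge0// exprMn real_normK.
  exact: cauchy_schwarz.
exact: num_real.
Qed.

Lemma enormZ a x : enorm (a *: x) = `|a| * enorm x.
Proof.
rewrite /enorm -sqrtr_sqr -sqrtrM ?sqr_ge0// mulr_sumr; congr Num.sqrt.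
by apply: eq_bigr => i _; rewrite mxE exprMn.
Qed.

Lemma normr_coord_le x i : `|x 0 i| <= enorm x.
Proof.
rewrite -(@ler_pXn2r _ 2) ?nnegrE ?enorm_ge0// sqr_enorm real_normK ?num_real//.
by rewrite (bigD1 i)//= lerDl sumr_ge0// => j _; exact: sqr_ge0.
Qed.

Lemma normr_le_enorm x : `|x| <= enorm x.
Proof.
rewrite [leLHS]/Num.Def.normr/= mx_normrE.
apply: bigmax_le => [|[i j] _ /=]; first exact: enorm_ge0.
by rewrite ord1 normr_coord_le.
Qed.

Lemma continuous_enorm : continuous (@enorm R n).
Proof.
move=> x; apply: continuous_comp; last exact: sqrt_continuous.
apply: continuous_at_sum => i.
by apply: continuous_atX; exact: coord_continuous.
Qed.

Lemma continuous_subr_cst (c : 'rV[R]_n) :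
  continuous (fun x : 'rV[R]_n => x - c).
Proof.
move=> x; apply: (@cvgB _ _ _ (nbhs x) _ id (cst c) x c).
  exact: cvg_id.
exact: cvg_cst.
Qed.

Lemma continuous_affine (x : 'rV[R]_n) (t : R) :
  continuous (fun y : 'rV[R]_n => x + t *: y).
Proof.
move=> y; apply: (@cvgD _ _ _ (nbhs y) _ (cst x) ( *:%R t) x (t *: y)).
  exact: cvg_cst.
exact: scaler_continuous.
Qed.

Lemma open_eball (c : 'rV[R]_n) r : open (eball c r).
Proof.
rewrite (_ : eball c r = (fun x => enorm (x - c)) @^-1` [set a | a < r])//.
apply: open_comp; last exact: open_lt.
move=> x _; apply: (@continuous_comp _ _ _ (fun x : 'rV[R]_n => x - c)).
  exact: continuous_subr_cst.
exact: continuous_enorm.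
Qed.

Lemma compact_cball (c : 'rV[R]_n) r : compact [set x | enorm (x - c) <= r].
Proof.
apply: bounded_closed_compact; last first.
  rewrite (_ : [set _ | _] = (fun x => enorm (x - c)) @^-1` [set a | a <= r])//.
  apply: closed_comp; last exact: closed_le.
  move=> x _; apply: (@continuous_comp _ _ _ (fun x : 'rV[R]_n => x - c)).
    exact: continuous_subr_cst.
  exact: continuous_enorm.
exists (`|c| + `|r|); split; first exact: num_real.
move=> M rM x /= xr; apply: le_trans (ltW rM); rewrite -(subrK c x).
rewrite (le_trans (ler_normD _ _))// addrC lerD2l.
by rewrite (le_trans (normr_le_enorm _))// (le_trans xr)// ler_norm.
Qed.

End euclidean_norm.

(** * Borel sets and measurable functions *)

(** An open set is the union of the boxes with rational corners that it contains,
    and there are countably many of these. *)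
Lemma open_measurable_rV {R : realType} {n : nat} (U : set 'rV[R]_n) :
  open U -> measurable U.
Proof.
move=> oU.
pose box (ab : 'rV[rat]_n * 'rV[rat]_n) : set 'rV[R]_n :=
  [set x | forall i, x 0 i \in `](ratr (ab.1 0 i)), (ratr (ab.2 0 i))[].
have mbox ab : measurable (box ab).
  apply: (@measurable_rV_box R n
    (fun i => `](ratr (ab.1 0 i) : R), ratr (ab.2 0 i)[%classic)) => i.
  exact: measurable_itv.
pose F ab := if `[< box ab `<=` U >] then box ab else set0.
rewrite (_ : U = \bigcup_ab F ab).
  apply: countable_bigcupT_measurable => [|ab]; first exact: countableP.
  by rewrite /F; case: ifP.
apply/seteqP; split => [x Ux|x [ab _]]; last first.
  by rewrite /F; case: asboolP => // + xab; exact.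
have : nbhs x U by exact: open_nbhs_nbhs.
move=> /nbhs_ballP[e /= e0 xeU].
have /choice[a Pa] (i : 'I_n) : exists q : rat,
    ratr q \in `](x 0 i - e), (x 0 i)[.
  have /rat_in_itvoo[q xq] : x 0 i - e < x 0 i by rewrite ltrBlDr ltrDl.
  by exists q.
have /choice[b Pb] (i : 'I_n) : exists q : rat,
    ratr q \in `](x 0 i), (x 0 i + e)[.
  have /rat_in_itvoo[q xq] : x 0 i < x 0 i + e by rewrite ltrDl.
  by exists q.
exists (\row_i a i, \row_i b i) => //.
rewrite /F asboolT /box/=.
  move=> i; rewrite !mxE in_itv/=.
  by have := Pa i; have := Pb i; rewrite !in_itv/= => /andP[-> _] /andP[_ ->].
move=> y /= yab; apply: xeU; split => // i j; rewrite ord1.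
have := yab j; rewrite !mxE in_itv/= => /andP[ay yb].
have := Pa j; have := Pb j; rewrite !in_itv/= => /andP[xb bx] /andP[xa ax].
rewrite /ball/= ltr_distlC; apply/andP; split.
  exact: lt_trans xa ay.
exact: lt_trans yb bx.
Qed.

Lemma open_continuous_measurable_rV {R : realType} {n : nat}
    (D : set 'rV[R]_n) (f : 'rV[R]_n -> R) :
  open D -> (forall x, D x -> {for x, continuous f}) -> measurable_fun D f.
Proof.
move=> oD cf; apply: (measurability _ (RGenOpens.measurableE R)).
move=> _ [_ [a [b ->] <-]]; apply: open_measurable_rV.
have /(continuous_inP _ oD) : {in D, continuous f} by move=> x /set_mem /cf.
by apply; exact: interval_open.
Qed.

Lemma continuous_measurable_rV {R : realType} {n : nat} (f : 'rV[R]_n -> R) :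
  continuous f -> measurable_fun setT f.
Proof.
move=> cf; apply: (open_continuous_measurable_rV openT) => x _; exact: cf.
Qed.

(** * Slicing and Fubini *)

(** A directional derivative depends only on the values along one line, so it can
    be computed in any affine parametrization [phi] of that line. This moves
    derivatives between a function of several variables and its restrictions to
    lines or coordinate slices. *)
Lemma is_derive_line {R : realType} {U V : normedModType R} (f : V -> R)
    (phi : U -> V) (y u : U) (v : V) (df : R) :
  (forall h, phi (h *: u + y) = h *: v + phi y) ->
  is_derive (phi y) v f df -> is_derive y u (f \o phi) df.
Proof.
move=> phiE [fder fval].
have E : (fun h => h^-1 *: (((f \o phi) \o shift y) (h *: u) - (f \o phi) y)) =
         (fun h => h^-1 *: ((f \o shift (phi y)) (h *: v) - f (phi y))).
  by apply/funext => h /=; rewrite phiE.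
by split; [rewrite /derivable E|rewrite /derive E].
Qed.

Section row_vector_cons.
Context {R : realType} {n : nat}.

Lemma coordZD {m} (h : R) (x y : 'rV[R]_m) i :
  (h *: x + y) 0 i = h * x 0 i + y 0 i.
Proof. by rewrite !mxE. Qed.

Lemma rV_cons_addl (a h : R) (v : 'rV[R]_n) :
  rV_cons ((h *: (1 : R) + a : R), v) =
  h *: delta_mx 0 ord0 + rV_cons (a : measurableTypeR R, v).
Proof.
apply/rowP => i; rewrite coordZD [in RHS]mxE/=.
case: (unliftP ord0 i) => [j ->|->].
  by rewrite !rV_consS/= mulr0 add0r.
by rewrite !rV_cons0/=.
Qed.

Lemma rV_cons_addr (a h : R) (v : 'rV[R]_n) (j : 'I_n) :
  rV_cons (a : measurableTypeR R, h *: delta_mx 0 j + v) =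
  h *: delta_mx 0 (lift ord0 j) + rV_cons (a : measurableTypeR R, v).
Proof.
apply/rowP => i; rewrite coordZD [in RHS]mxE/=.
case: (unliftP ord0 i) => [k ->|->].
  by rewrite !rV_consS/= coordZD mxE/= (inj_eq lift_inj).
by rewrite !rV_cons0/= mulr0 add0r.
Qed.

Lemma continuous_rV_consl (v : 'rV[R]_n) :
  continuous (fun a : R => rV_cons (a : measurableTypeR R, v)).
Proof.
rewrite (_ : (fun _ => _) =
    (fun a : R => a *: delta_mx 0 ord0 + rV_cons (0 : measurableTypeR R, v))).
  move=> a; apply: cvgD; [exact: scalel_continuous|exact: cvg_cst].
apply/funext => a; rewrite -rV_cons_addl; congr (rV_cons (_, _)).
by rewrite [a *: _]mulr1 addr0.
Qed.

Lemma continuous_rV_consr (a : R) :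
  continuous (fun v : 'rV[R]_n => rV_cons (a : measurableTypeR R, v)).
Proof.
move=> v U /nbhs_ballP[e e0 eU]; apply/nbhs_ballP; exists e => //= w [_ vw].
apply: eU; split => // i j; rewrite ord1.
case: (unliftP ord0 j) => [k ->|->].
  by rewrite !rV_consS/=; exact: vw.
by rewrite !rV_cons0/=; exact: ballxx.
Qed.

End row_vector_cons.

Section fubini_rV.
Context {R : realType} {n : nat}.
Local Open Scope ereal_scope.
Variable F : 'rV[R]_n.+1 -> \bar R.

Lemma ge0_integral_rV_cons :
  measurable_fun [set: 'rV[R]_n.+1] F -> (forall x, 0 <= F x) ->
  \int[lebesgue_rV R n.+1]_x F x =
  \int[lebesgue_measure]_a \int[lebesgue_rV R n]_v F (rV_cons (a, v)).
Proof.
move=> mF F0; rewrite /= /lebesgue_rV_next ge0_integral_pushforward//; last first.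
  exact: measurable_rV_cons.
rewrite preimage_setT fubini_tonelli1//.
  by apply: measurableT_comp => //; exact: measurable_rV_cons.
by move=> z; exact: F0.
Qed.

Hypothesis intF : (lebesgue_rV R n.+1).-integrable [set: 'rV[R]_n.+1] F.

Let intFcons : (lebesgue_measure \x lebesgue_rV R n).-integrable setT
  (F \o @rV_cons R n).
Proof.
have /integrableP[mF iF] := intF.
apply/integrableP; split.
  by apply: measurableT_comp => //; exact: measurable_rV_cons.
move: iF; rewrite /= /lebesgue_rV_next ge0_integral_pushforward//.
- exact: measurable_rV_cons.
- by apply: measurableT_comp.
Qed.

Let integral_rV_next : \int[lebesgue_rV R n.+1]_x F x =
  \int[lebesgue_measure \x lebesgue_rV R n]_z (F \o @rV_cons R n) z.
Proof.
rewrite /= /lebesgue_rV_next integral_pushforward//.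
- exact: measurable_rV_cons.
- exact: measurable_int intF.
Qed.

Lemma integral_rV_cons12 : \int[lebesgue_rV R n.+1]_x F x =
  \int[lebesgue_measure]_a \int[lebesgue_rV R n]_v F (rV_cons (a, v)).
Proof. by rewrite integral_rV_next -integral12_prod_meas1. Qed.

Lemma integral_rV_cons21 : \int[lebesgue_rV R n.+1]_x F x =
  \int[lebesgue_rV R n]_v \int[lebesgue_measure]_a F (rV_cons (a, v)).
Proof. by rewrite integral_rV_next -integral21_prod_meas1. Qed.

End fubini_rV.

(** * Integrals of partial derivatives over the cube *)

(** The kernels below live on the unit ball, but integrals are taken over this
    cube: its slices by coordinate hyperplanes are again cubes, which is what
    iterated integration needs. *)
Definition cube (R : realType) (n : nat) : set 'rV[R]_n :=
  [set x | forall i, `[(-1 : R), 1]%classic (x 0 i)].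
Arguments cube : clear implicits.

Section cube.
Context {R : realType}.
Implicit Types n : nat.

Lemma measurable_cube n : measurable (cube R n).
Proof. by apply: (@measurable_rV_box R n (fun=> `[-1, 1]%classic)) => i. Qed.

Lemma lebesgue_cube_lty n : (lebesgue_rV R n (cube R n) < +oo)%E.
Proof.
rewrite /cube (@lebesgue_rV_box R n (fun=> `[-1, 1]%classic))//.
under eq_bigr do rewrite lebesgue_measure_itv/= lte_fin gtrN// -EFinD.
by rewrite prodEFin ltry.
Qed.

Lemma compact_cube n : compact (cube R n).
Proof.
apply: (@rV_compact R n (fun=> `[-1, 1]%classic)) => i.
exact: segment_compact.
Qed.

Lemma continuous_cube_integrable n (f : 'rV[R]_n -> R) : continuous f ->
  (lebesgue_rV R n).-integrable (cube R n) (EFin \o f).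
Proof.
move=> cf; apply: measurable_bounded_integrable.
- exact: measurable_cube.
- exact: lebesgue_cube_lty.
- by apply: measurable_funTS; exact: continuous_measurable_rV.
- have : compact (f @` cube R n).
    apply: continuous_compact; last exact: compact_cube.
    exact: continuous_subspaceT.
  move=> /compact_bounded[M [Mr fM]]; exists M; split => // N MN x Qx.
  by apply: (fM _ MN); exists x.
Qed.

Lemma cube_rV_cons n (a : R) (v : 'rV[R]_n) :
  cube R n.+1 (rV_cons (a : measurableTypeR R, v)) <->
  a \in `[-1, 1] /\ cube R n v.
Proof.
split => [Q|[a1 Qv] i].
  split; first by have := Q ord0; rewrite rV_cons0.
  by move=> i; have := Q (lift ord0 i); rewrite rV_consS.
by case: (unliftP ord0 i) => [j ->|->]; rewrite ?rV_consS ?rV_cons0//; exact: Qv.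
Qed.

Let patch_cube_cons n (f : 'rV[R]_n.+1 -> R) (a : measurableTypeR R) v :
  ((EFin \o f) \_ (cube R n.+1)) (rV_cons (a, v)) =
  if (a \in `[-1, 1]%classic) && (v \in cube R n)
  then (f (rV_cons (a, v)))%:E else 0%E.
Proof.
rewrite patchE; congr (if _ then _ else _).
apply/idP/andP; rewrite !inE; last by move=> [a1 Qv]; exact/cube_rV_cons.
by move=> /cube_rV_cons.
Qed.

Let integrable_patch n (f : 'rV[R]_n -> R) : continuous f ->
  (lebesgue_rV R n).-integrable [set: 'rV[R]_n] ((EFin \o f) \_ (cube R n)).
Proof.
move=> cf; rewrite -integrable_mkcond; last exact: measurable_cube.
exact: continuous_cube_integrable.
Qed.

Local Open Scope ereal_scope.

Lemma integral_cube12 n (f : 'rV[R]_n.+1 -> R) : continuous f ->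
  \int[lebesgue_rV R n.+1]_(x in cube R n.+1) (f x)%:E =
  \int[lebesgue_measure]_(a in `[(-1)%R, 1%R])
    \int[lebesgue_rV R n]_(v in cube R n) (f (rV_cons (a, v)))%:E.
Proof.
move=> cf; rewrite integral_mkcond integral_rV_cons12; last first.
  exact: integrable_patch.
rewrite [RHS]integral_mkcond; apply: eq_integral => a _.
rewrite patchE; case: ifPn => a1.
  rewrite [RHS]integral_mkcond; apply: eq_integral => v _.
  by rewrite patch_cube_cons a1/= patchE.
by rewrite integral0_eq// => v _; rewrite patch_cube_cons (negbTE a1).
Qed.

Lemma integral_cube21 n (f : 'rV[R]_n.+1 -> R) : continuous f ->
  \int[lebesgue_rV R n.+1]_(x in cube R n.+1) (f x)%:E =
  \int[lebesgue_rV R n]_(v in cube R n)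
    \int[lebesgue_measure]_(a in `[(-1)%R, 1%R]) (f (rV_cons (a, v)))%:E.
Proof.
move=> cf; rewrite integral_mkcond integral_rV_cons21; last first.
  exact: integrable_patch.
rewrite [RHS]integral_mkcond; apply: eq_integral => v _.
rewrite patchE; case: ifPn => Qv.
  rewrite [RHS]integral_mkcond; apply: eq_integral => a _.
  by rewrite patch_cube_cons Qv andbT patchE.
by rewrite integral0_eq// => a _; rewrite patch_cube_cons (negbTE Qv) andbF.
Qed.

(** The divergence theorem for a field with a single nonzero component that
    vanishes on the two faces it crosses: integrating first along the [i]-th
    axis, the fundamental theorem of calculus gives the difference of two
    boundary values, both zero. When [i] is not the first coordinate, the first
    one is integrated last and the inner integral is the same statement in one
    dimension less. *)
Lemma integral_cube_partial n (i : 'I_n) (f g : 'rV[R]_n -> R) :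
  continuous g -> (forall x : 'rV[R]_n, is_derive x (delta_mx 0 i) f (g x))%R ->
  (forall x : 'rV[R]_n, `|x 0 i| = 1 -> f x = 0)%R ->
  \int[lebesgue_rV R n]_(x in cube R n) (g x)%:E = 0.
Proof.
elim: n i f g => [[]//|n IH] i f g cg fg f0.
case: (unliftP ord0 i) => [j ij|i0].
  rewrite integral_cube12//; apply: integral0_eq => a _.
  apply: (IH j (fun v => f (rV_cons (a, v)))).
  - move=> v; apply: (@continuous_comp _ _ _ (fun v => rV_cons (a, v)) g).
      exact: continuous_rV_consr.
    exact: cg.
  - move=> v; apply: (is_derive_line (V := 'rV[R]_n.+1) (f := f)
      (phi := fun v => rV_cons (a, v)) (v := delta_mx 0%R i)).
    by move=> h; rewrite ij; exact: rV_cons_addr.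
  - by move=> v v1; apply: f0; rewrite ij rV_consS.
rewrite integral_cube21//; apply: integral0_eq => v _.
pose k (a : R) := g (rV_cons (a : measurableTypeR R, v)).
pose K (a : R) := f (rV_cons (a : measurableTypeR R, v)).
have ck : continuous k.
  move=> a; apply: (@continuous_comp _ _ _
    (fun a : R => rV_cons (a : measurableTypeR R, v)) g).
    exact: continuous_rV_consl.
  exact: cg.
have dK (a : R) : is_derive a (1 : R)%R K (k a).
  apply: (is_derive_line (U := R) (V := 'rV[R]_n.+1) (f := f)
    (phi := fun a : R => rV_cons (a : measurableTypeR R, v))
    (v := delta_mx 0%R i)).
  by move=> h; rewrite i0; exact: rV_cons_addl.
have cK : continuous K.
  move=> a; apply: differentiable_continuous; apply/derivable1_diffP.
  by have [] := dK a.
rewrite (@continuous_FTC2 R k K (-1)%R 1%R).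
- by rewrite /K !f0 ?subee// i0 rV_cons0/= ?normrN normr1.
- by rewrite gtrN.
- exact: continuous_subspaceT.
- split.
  + by move=> a _; have [] := dK a.
  + exact/cvg_at_right_filter/cK.
  + exact/cvg_at_left_filter/cK.
- by move=> a _; rewrite derive1E; have [_] := dK a.
Qed.

End cube.

(** * Affine changes of variables *)

Section affine_change_of_variables.
Context {R : realType}.
Local Open Scope ereal_scope.

(** The image of Lebesgue measure under [a |-> x + d * a], multiplied by [d], has
    the right value on half-open intervals, hence is Lebesgue measure. *)
Lemma ge0_integral_affine (x d : R) (F : measurableTypeR R -> \bar R) :
  (0 < d)%R -> measurable_fun setT F -> (forall a, 0 <= F a) ->
  d%:E * \int[lebesgue_measure]_a F (x + d * a)%R =
  \int[lebesgue_measure]_a F a.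
Proof.
move=> d0 mF F0.
pose phi (a : measurableTypeR R) : measurableTypeR R := (x + d * a)%R.
have mphi : measurable_fun setT phi.
  by apply: measurable_funD => //; apply: measurable_funM.
pose dnn : {nonneg R} := NngNum (ltW d0).
have scaleE A : measurable A -> lebesgue_measure A =
    mscale dnn (pushforward (@lebesgue_measure R) (mfun_Sub (mem_set mphi))) A.
  move: A; apply: lebesgue_measure_unique => _ [[a b] _ <-] /=.
  rewrite /mscale/= /pushforward.
  rewrite (_ : _ @^-1` _ = `](a - x) / d, (b - x) / d]%classic)%R.
    rewrite !lebesgue_measure_itv/= !lte_fin ltr_pM2r ?invr_gt0// ltrD2r.
    case: ifPn => _; last by rewrite mule0.
    rewrite -EFinD -EFinM -mulrBl mulrC divfK ?gt_eqF//; congr (_%:E).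
    lra.
  apply/seteqP; split => z; rewrite /= /phi !in_itv/=;
  by rewrite ltr_pdivrMr// ler_pdivlMr// ltrBlDr lerBrDr (mulrC z) (addrC _ x).
rewrite [RHS](eq_measure_integral
    (mscale dnn (pushforward (@lebesgue_measure R) (mfun_Sub (mem_set mphi)))));
  last by move=> A mA _; exact: scaleE.
rewrite ge0_integral_mscale//; congr (_ * _).
by rewrite ge0_integral_pushforward.
Qed.

Lemma measurable_rV_affine n (x : 'rV[R]_n) (d : R) :
  measurable_fun setT (fun y : 'rV[R]_n => x + d *: y)%R.
Proof.
apply: measurable_fun_rVP => i.
rewrite (_ : _ \o _ = fun y => x ord0 i + d * rV_coord i y)%R; last first.
  by apply/funext => y; rewrite /= /rV_coord !mxE.
apply: measurable_funD => //; apply: measurable_funM => //.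
exact: measurable_rV_coord.
Qed.

Lemma ge0_integral_rV_affine n (x : 'rV[R]_n) (d : R) (F : 'rV[R]_n -> \bar R) :
  (0 < d)%R -> measurable_fun setT F -> (forall y, 0 <= F y) ->
  (d ^+ n)%:E * \int[lebesgue_rV R n]_y F (x + d *: y)%R =
  \int[lebesgue_rV R n]_y F y.
Proof.
move=> d0; elim: n x F => [|n IH] x F mF F0.
  rewrite expr0 mul1e; apply: eq_integral => y _.
  by congr F; apply/rowP => -[].
have maff := measurable_rV_affine x d.
rewrite ge0_integral_rV_cons//; last exact: measurableT_comp.
rewrite [RHS]ge0_integral_rV_cons//.
have mFc : measurable_fun setT (F \o @rV_cons R n).
  by apply: measurableT_comp => //; exact: measurable_rV_cons.
pose H a := \int[lebesgue_rV R n]_v F (rV_cons (a, v)).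
have mH : measurable_fun setT H.
  apply: (measurable_fun_fubini_tonelli_F (F \o @rV_cons R n)) => //.
  by move=> z; exact: F0.
have H0 a : 0 <= H a by apply: integral_ge0.
transitivity (d%:E * \int[lebesgue_measure]_a H (x ord0 ord0 + d * a)%R).
  2: exact: (ge0_integral_affine _ d0 mH H0).
pose x' := (\row_i x ord0 (lift ord0 i))%R.
have E a v : (x + d *: rV_cons (a, v) =
    rV_cons ((x ord0 ord0 + d * a)%R : measurableTypeR R, x' + d *: v))%R.
  apply/rowP => i; rewrite (addrC x) (addrC x') coordZD.
  case: (unliftP ord0 i) => [j ->|->]; last by rewrite !rV_cons0/= addrC.
  by rewrite !rV_consS/= coordZD mxE.
rewrite exprS EFinM -muleA -ge0_integralZl//.
- congr (_ * _); apply: eq_integral => a _.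
  rewrite /H -(IH x' (fun v =>
      F (rV_cons ((x ord0 ord0 + d * a)%R : measurableTypeR R, v))))//.
    by congr (_ * _); apply: eq_integral => v _; rewrite E.
  exact: (measurableT_comp mFc (pair1_measurable _)).
- pose F' := (fun y => F (x + d *: y))%R.
  apply: (measurable_fun_fubini_tonelli_F (F' \o @rV_cons R n)) => //.
    apply: measurableT_comp => //; last exact: measurable_rV_cons.
    exact: measurableT_comp.
  by move=> z; exact: F0.
- by move=> a _; exact: integral_ge0.
- by rewrite lee_fin exprn_ge0// ltW.
Qed.

End affine_change_of_variables.

(** * The chain rule for continuous partial derivatives *)

(** The mean value theorem applied to [s |-> g s - s * c], for endpoints in either
    order. *)
Lemma is_derive_increment_le {R : realType} (g g' : R -> R) (a b c e : R) :
  (forall s, Order.min a b <= s <= Order.max a b -> is_derive s 1 g (g' s)) ->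
  (forall s, Order.min a b <= s <= Order.max a b -> `|g' s - c| <= e) ->
  `|g b - g a - (b - a) * c| <= e * `|b - a|.
Proof.
wlog ab : a b / a <= b => [hwlog|].
  have /orP[|ba] := le_total a b; first exact: hwlog.
  move=> dg gc; rewrite (distrC b a).
  have -> : `|g b - g a - (b - a) * c| = `|g a - g b - (a - b) * c|.
    by rewrite -[LHS]normrN; congr `|_|; ring.
  by apply: (hwlog _ _ ba); rewrite minC maxC.
rewrite min_l// max_r// => dg gc.
have dg' s : s \in `]a, b[%R -> is_derive s 1 g (g' s).
  by move=> /subset_itv_oo_cc; rewrite in_itv; exact: dg.
have cg : {within `[a, b], continuous g}.
  apply: derivable_within_continuous => s; rewrite in_itv => sab.
  by have [] := dg s sab.
have [s s01 ->] := MVT_segment ab dg' cg.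
rewrite (mulrC (b - a)) -mulrBl normrM ler_wpM2r//.
by apply: gc; move: s01; rewrite in_itv.
Qed.

Section chain_rule.
Context {R : realType} {n : nat}.
Implicit Types (f : 'rV[R]_n -> R) (x y : 'rV[R]_n).

(** The points [trunc_rV h k], for [k] from [0] to [n], are the vertices of a
    path from [0] to [h] whose edges are parallel to the axes. *)
Definition trunc_rV (h : 'rV[R]_n) (k : nat) : 'rV[R]_n :=
  \row_(i < n) (if (i < k)%N then h 0 i else 0).

Let trunc_rVS (h : 'rV[R]_n) (k : 'I_n) :
  trunc_rV h k.+1 = h 0 k *: delta_mx 0 k + trunc_rV h k.
Proof.
apply/rowP => i; rewrite !mxE/= ltnS leq_eqVlt.
have [->|ik] := eqVneq i k; first by rewrite eqxx ltnn mulr1 addr0.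
by rewrite (_ : _ == _ :> nat = false) ?mulr0 ?add0r//; apply/negbTE.
Qed.

Let ball_trunc_rV (h : 'rV[R]_n) (k : 'I_n) x e s : `|h| < e ->
  Order.min 0 (h 0 k) <= s <= Order.max 0 (h 0 k) ->
  ball x e (s *: delta_mx 0 k + (x + trunc_rV h k)).
Proof.
move=> he /andP[s0 s1]; rewrite -ball_normE/=.
rewrite (_ : x - _ = - (s *: delta_mx 0 k + trunc_rV h k)) ?normrN; last first.
  by rewrite !opprD addrCA addNKr.
apply: le_lt_trans he; rewrite [leLHS]/Num.Def.normr/= mx_normrE.
have hle i : `|h 0 i| <= `|h|.
  rewrite [leRHS]/Num.Def.normr/= mx_normrE.
  exact: (le_bigmax _ (fun ij : 'I_1 * 'I_n => `|h ij.1 ij.2|) (0, i)).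
apply: bigmax_le => [|[i j] _ /=]; first exact: normr_ge0.
rewrite ord1 !mxE/=; have [->|jk] := eqVneq j k.
  rewrite ltnn mulr1 addr0; apply: le_trans (hle k).
  move: s0 s1; case: (leP 0 (h 0 k)) => h0.
    by move=> s0 sh; rewrite !ger0_norm.
  by move=> s0 sh; rewrite !ler0_norm ?lerN2// ltW.
by rewrite mulr0 add0r; case: ifP => _; rewrite ?normr0.
Qed.

(** Along each edge of the path through the points [x + trunc_rV h k] a single
    coordinate varies, so its increment is controlled by one partial derivative,
    which by continuity is within [e] of its value at [x]. *)
Lemma C1_increment_le f x (e : R) : 0 < e ->
  (\forall y \near x, forall i, derivable f y (delta_mx 0 i)) ->
  (forall i, {for x, continuous (partial i f)}) ->
  \forall h \near (0 : 'rV[R]_n),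
    `|f (x + h) - f x - \sum_(i < n) h 0 i * partial i f x| <=
    e * \sum_(i < n) `|h 0 i|.
Proof.
move=> e0 df cf.
have nearc : \forall y \near x, forall i, `|partial i f y - partial i f x| <= e.
  apply: (@filter_forall _ _ _ (nbhs x) _) => i.
  by move/cvgr_dist_le : (cf i) => /(_ e e0); apply: filterS => y; rewrite distrC.
have : nbhs x ([set y | forall i, derivable f y (delta_mx 0 i)] `&`
    [set y | forall i, `|partial i f y - partial i f x| <= e]) by exact: filterI.
move=> /nbhs_ballP[r /= r0 xr].
apply/nbhs_ballP; exists r => //= h; rewrite -ball_normE/= sub0r normrN => hr.
pose T k := f (x + trunc_rV h k).
have -> : f (x + h) - f x = \sum_(i < n) (T i.+1 - T i).
  rewrite -(big_mkord xpredT (fun i => T i.+1 - T i)) telescope_sumr// /T.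
  congr (f _ - f _); first by congr (_ + _); apply/rowP => i; rewrite mxE ltn_ord.
  by rewrite (_ : trunc_rV h 0 = 0) ?addr0//; apply/rowP => i; rewrite !mxE.
rewrite -sumrB mulr_sumr (le_trans (ler_norm_sum _ _ _))//.
apply: ler_sum => i _.
pose g s := f (s *: delta_mx 0 i + (x + trunc_rV h i)).
have -> : T i.+1 = g (h 0 i) by rewrite /T trunc_rVS /g addrCA.
have -> : T i = g 0 by rewrite /g scale0r add0r.
have := @is_derive_increment_le _ g
  (fun s => partial i f (s *: delta_mx 0 i + (x + trunc_rV h i))) 0 (h 0 i)
  (partial i f x) e.
rewrite !subr0; apply.
- move=> s shi; apply: (is_derive_line (U := R) (V := 'rV[R]_n) (f := f)
    (phi := fun s : R => s *: delta_mx 0 i + (x + trunc_rV h i))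
    (v := delta_mx 0 i)).
    by move=> t; rewrite scalerDl [t *: _]mulr1 -addrA.
  have [dfx _] := xr _ (@ball_trunc_rV h i x r s hr shi).
  exact: derivableP.
- by move=> s shi; have [_] := xr _ (@ball_trunc_rV h i x r s hr shi).
Qed.

(** Continuous partial derivatives give the derivative in every direction; this
    is the chain rule along a ray. *)
Lemma C1_is_derive f x y :
  (\forall z \near x, forall i, derivable f z (delta_mx 0 i)) ->
  (forall i, {for x, continuous (partial i f)}) ->
  is_derive x y f (\sum_(i < n) y 0 i * partial i f x).
Proof.
move=> df cf; set l := \sum_i _.
suff cvgl : (fun h => h^-1 *: ((f \o shift x) (h *: y) - f x)) @ 0^' --> l.
  by apply: DeriveDef; [apply/cvg_ex; exists l|exact: (cvg_lim _ cvgl)].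
apply/cvgrPdist_le => e e0.
pose S := 1 + \sum_(i < n) `|y 0 i|.
have S0 : 0 < S by rewrite ltr_pwDl// sumr_ge0.
have := C1_increment_le (divr_gt0 e0 S0) df cf => near0.
have cvg0 : h *: y @[h --> (0 : R)] --> (0 : 'rV[R]_n).
  by rewrite -[X in _ --> X](scale0r y); exact: scalel_continuous.
have := cvg0 _ near0; rewrite nbhs_filterE => near0'.
near=> h.
have h0 : h != 0 by near: h; exact: nbhs_dnbhs_neq.
have hle : `|f (x + h *: y) - f x - \sum_(i < n) (h *: y) 0 i * partial i f x| <=
    e / S * \sum_(i < n) `|(h *: y) 0 i|.
  by near: h; exact: nbhs_dnbhs.
rewrite distrC -(ler_pM2l (x := `|h|)) ?normr_gt0// -normrM mulrBr.
rewrite [h * (_ *: _)]mulrA divff// mul1r [(_ \o _) _]/= [_ + x]addrC.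
have -> : h * l = \sum_(i < n) (h *: y) 0 i * partial i f x.
  by rewrite /l mulr_sumr; apply: eq_bigr => i _; rewrite mxE mulrA.
apply: (le_trans hle).
under eq_bigr do rewrite mxE normrM.
rewrite -mulr_sumr mulrCA ler_wpM2l// -mulrA ler_piMr ?(ltW e0)//.
by rewrite mulrC ler_pdivrMr// mul1r /S lerDr.
Unshelve. all: by end_near. Qed.

End chain_rule.

(** * Smooth and convex functions *)

Section smooth_functions.
Context {R : realType} {n : nat}.
Implicit Types (Omega : set 'rV[R]_n) (f : 'rV[R]_n -> R).

Lemma smooth_on_partials Omega f (s : seq 'I_n) :
  smooth_on Omega f -> smooth_on Omega (partials s f).
Proof.
move=> sf s' x Ox; rewrite /partials -foldr_cat; exact: (sf (s' ++ s) x Ox).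
Qed.

(** Differentiating repeatedly needs the equality on a neighbourhood at each step,
    which is why [Omega] is open. *)
Lemma partials_sum Omega m (f : 'I_m -> 'rV[R]_n -> R) (s : seq 'I_n) x :
  open Omega ->
  (forall i, smooth_on Omega (f i)) -> Omega x ->
  partials s (fun y => \sum_(i < m) f i y) x = \sum_(i < m) partials s (f i) x.
Proof.
move=> oO sf; elim: s x => [//|j s IH] x Ox.
rewrite [LHS]/= /partial.
have near_sum : \near x, partials s (fun y => \sum_(i < m) f i y) x =
    (\sum_(i < m) partials s (f i)) x.
  have : nbhs x Omega by exact: open_nbhs_nbhs.
  by apply: filterS => y Oy; rewrite IH// fct_sumE.
rewrite (near_eq_derive _ near_sum) derive_sum// => i.
by have [_] := sf i s x Ox; exact.
Qed.

Lemma smooth_on_sum Omega m (f : 'I_m -> 'rV[R]_n -> R) : open Omega ->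
  (forall i, smooth_on Omega (f i)) ->
  smooth_on Omega (fun y => \sum_(i < m) f i y).
Proof.
move=> oO sf s x Ox.
have nearO : nbhs x Omega by exact: open_nbhs_nbhs.
have sumE y : Omega y -> \sum_(i < m) partials s (f i) y =
    partials s (fun y => \sum_(i < m) f i y) y.
  by move=> Oy; rewrite (@partials_sum Omega).
split.
  have cS : {for x, continuous (fun y => \sum_(i < m) partials s (f i) y)}.
    by apply: continuous_at_sum => i; have [] := sf i s x Ox.
  rewrite /prop_for /continuous_at -sumE//.
  apply: cvg_trans cS; apply: (@near_eq_cvg _ _ (nbhs x)).
  by apply: filterS nearO => y Oy; rewrite sumE.
move=> j.
have near_sum : \near x, (\sum_(i < m) partials s (f i)) x =
    partials s (fun y => \sum_(i < m) f i y) x.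
  by apply: filterS nearO => y Oy; rewrite fct_sumE sumE.
apply: near_eq_derivable near_sum _; apply: derivable_sum => i.
by have [_] := sf i s x Ox; exact.
Qed.

Lemma smooth_on_laplacian Omega f : open Omega ->
  smooth_on Omega f -> smooth_on Omega (laplacian f).
Proof.
move=> oO sf; rewrite /laplacian.
exact: (smooth_on_sum oO (fun i => smooth_on_partials [:: i; i] sf)).
Qed.

Lemma smooth_on_is_derive Omega f x y : open Omega -> smooth_on Omega f ->
  Omega x -> is_derive x y f (\sum_(i < n) y 0 i * partial i f x).
Proof.
move=> oO sf Ox; apply: C1_is_derive => [|i].
  have : nbhs x Omega by exact: open_nbhs_nbhs.
  by apply: filterS => z Oz i; have [_] := sf [::] z Oz; exact.
by have [] := sf [:: i] x Ox.
Qed.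

Lemma convex_set_ball (x : 'rV[R]_n) (e : R) : @convex_set R 'rV[R]_n (ball x e).
Proof.
move=> a b l; rewrite !inE -!ball_normE/= => ax bx.
set z := conv _ _ _.
have -> : x - z = l%:num *: (x - a) + (1 - l%:num) *: (x - b).
  rewrite /z /conv/= !scalerBr !scalerBl !scale1r /unstable.onem.
  by apply/rowP => i; rewrite !mxE; ring.
apply: le_lt_trans (ler_normD _ _) _; rewrite !normrZ.
have l0 : 0 <= l%:num by [].
have l1 : 0 <= 1 - l%:num by rewrite subr_ge0.
rewrite !ger0_norm//.
by have [->|l0'] := eqVneq (l%:num) 0; [rewrite mul0r add0r subr0 mul1r|nra].
Qed.

Lemma convex_on_midpoint Omega f (x h : 'rV[R]_n) (e : R) :
  convex_on Omega f -> ball x e `<=` Omega -> `|h| < e ->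
  2 * f x <= f (x + h) + f (x - h).
Proof.
move=> cf xO he.
have half1 : (2^-1 : R) <= 1 by lra.
have half0 : 0 <= (2^-1 : R) by lra.
have xh : ball x e (x + h).
  by rewrite -ball_normE/= opprD addNKr normrN.
have xhN : ball x e (x - h) by rewrite -ball_normE/= opprB addrCA subrr addr0.
have : f (2^-1 *: (x + h) + (1 - 2^-1) *: (x - h)) <=
    2^-1 * f (x + h) + (1 - 2^-1) * f (x - h).
  exact: (cf _ (@convex_set_ball x e) xO (Itv01 half0 half1) (x + h) (x - h)
    (mem_set xh) (mem_set xhN)).
have -> : 2^-1 *: (x + h) + (1 - 2^-1) *: (x - h) = x.
  by apply/rowP => i; rewrite !mxE; field.
lra.
Qed.

(** If the second derivative were negative at [x], it would be negative on a ball
    by continuity; two applications of the mean value theorem to [f] and one to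
    its derivative along the segment of direction [i] would then contradict
    midpoint convexity. *)
Lemma convex_on_partials_ge0 Omega f i x : open Omega -> smooth_on Omega f ->
  convex_on Omega f -> Omega x -> 0 <= partials [:: i; i] f x.
Proof.
move=> oO sf cf Ox; rewrite leNgt; apply/negP => lt0.
pose v : 'rV[R]_n := delta_mx 0 i.
have nearO : nbhs x (Omega `&` [set y | partials [:: i; i] f y < 0]).
  apply: filterI; first exact: open_nbhs_nbhs.
  have [cfx _] := sf [:: i; i] x Ox.
  exact: (cvgr_lt _ cfx).
have [e /= e0 xe] := (nbhs_ballP _ _).1 nearO.
have normv : `|v| <= 1.
  rewrite [leLHS]/Num.Def.normr/= mx_normrE; apply: bigmax_le => //= -[a b] _ /=.
  by rewrite /v mxE ord1 eqxx/=; case: eqP => _; rewrite ?normr1 ?normr0.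
pose phi (s : R) := s *: v + x.
have phie (s : R) : `|s| < e -> ball x e (phi s).
  move=> se; rewrite -ball_normE/= /phi opprD addrCA subrr addr0 normrN normrZ.
  by apply: le_lt_trans se; rewrite ler_piMr.
have phiO (s : R) : `|s| < e -> Omega (phi s) by move=> /phie/xe[].
have dline (g : 'rV[R]_n -> R) (s : R) : smooth_on Omega g -> `|s| < e ->
    is_derive s 1 (g \o phi) (partial i g (phi s)).
  move=> sg se; apply: (is_derive_line (U := R) (V := 'rV[R]_n) (f := g)
    (phi := phi) (v := v)).
    by move=> t; rewrite /phi scalerDl [t *: _]mulr1 -addrA.
  by apply: derivableP; have [_] := sg [::] _ (phiO s se); exact.
have mvt (g : 'rV[R]_n -> R) a b : smooth_on Omega g -> (a : R) < b ->
    - e < a -> b < e ->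
    exists2 c, a < c < b & g (phi b) - g (phi a) = partial i g (phi c) * (b - a).
  move=> sg ab ae be.
  have sube (s : R) : a <= s <= b -> `|s| < e.
    move=> /andP[as_ sb].
    by rewrite ltr_norml (lt_le_trans ae)//= (le_lt_trans sb).
  have cg : {within `[a, b], continuous (g \o phi)}.
    apply: derivable_within_continuous => s; rewrite in_itv => sab.
    by have [] := dline g s sg (sube s sab).
  have dg s : s \in `]a, b[ -> is_derive s 1 (g \o phi) (partial i g (phi s)).
    move=> /subset_itv_oo_cc; rewrite in_itv => sab; exact: dline (sube s sab).
  have [c] := MVT ab dg cg.
  by rewrite in_itv/=; exists c.
pose h := e / 2.
have h0 : 0 < h by rewrite divr_gt0.
have he : h < e by rewrite /h; lra.
(* [c1] and [c2] are mean value points on either side of [x]; [c3] lies between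
   them and carries the second derivative. *)
have [||c1 /andP[c1a c1b] E1] := mvt f 0 h sf h0; [lra|lra|].
have [|||c2 /andP[c2a c2b] E2] := mvt f (- h) 0 sf; [lra|lra|lra|].
have [|||c3 /andP[c3a c3b] E3] := mvt _ c2 c1 (smooth_on_partials [:: i] sf);
  [lra|lra|lra|].
have : partials [:: i; i] f (phi c3) < 0.
  by apply: (xe _ (phie c3 _)).2; rewrite ltr_norml; apply/andP; split; lra.
have := convex_on_midpoint (h := h *: v) cf (fun y xy => (xe y xy).1).
rewrite normrZ gtr0_norm// => /(_ (le_lt_trans _ he)).
rewrite ler_piMr ?(ltW h0)// => /(_ isT).
have -> : x + h *: v = phi h by rewrite addrC.
have -> : x - h *: v = phi (- h) by rewrite /phi scaleNr addrC.
have -> : x = phi 0 by rewrite /phi scale0r add0r.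
move: E1 E2 E3 => /=; rewrite subr0 sub0r opprK.
move: (f (phi h)) (f (phi 0)) (f (phi (- h))) (partial i f (phi c1))
  (partial i f (phi c2)) (partial i (partial i f) (phi c3)) => a b c d1 d2 d3.
move=> E1 E2 E3 mid d30.
have : d2 <= d1 by nra.
have : d3 * (c1 - c2) < 0 by nra.
lra.
Qed.

Lemma convex_on_laplacian_ge0 Omega f x : open Omega -> smooth_on Omega f ->
  convex_on Omega f -> Omega x -> 0 <= laplacian f x.
Proof.
move=> oO sf cf Ox; apply: sumr_ge0 => i _.
exact: (@convex_on_partials_ge0 Omega).
Qed.

End smooth_functions.

(** * The radial kernel *)

(** Reading the derivative off a quadratic error bound avoids splitting cases
    according to the branch of a maximum. *)
Lemma is_derive_quadratic {R : realType} {V : normedModType R} (f : V -> R)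
    (y v : V) (df C : R) :
  (forall h, `|h| <= 1 -> `|f (h *: v + y) - f y - h * df| <= C * h ^+ 2) ->
  is_derive y v f df.
Proof.
move=> fC.
suff cvgl : (fun h => h^-1 *: ((f \o shift y) (h *: v) - f y)) @ 0^' --> df.
  by apply: DeriveDef; [apply/cvg_ex; exists df|exact: (cvg_lim _ cvgl)].
apply/cvgrPdist_le => e e0.
pose d := Num.min 1 (e / (1 + `|C|)).
have C0 : 0 < 1 + `|C| by rewrite ltr_pwDl.
have d0 : 0 < d by rewrite lt_min ltr01 divr_gt0.
near=> h.
have h0 : h != 0 by near: h; exact: nbhs_dnbhs_neq.
have hd : `|h| < d by near: h; exact: dnbhs0_lt.
move: hd; rewrite lt_min => /andP[h1 he].
rewrite distrC -(ler_pM2l (x := `|h|)) ?normr_gt0// -normrM mulrBr.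
rewrite [h * (_ *: _)]mulrA divff// mul1r [(_ \o _) _]/=.
apply: le_trans (fC _ (ltW h1)) _.
rewrite -real_normK ?num_real// expr2 mulrCA ler_wpM2l//.
rewrite ltr_pdivlMr// in he.
apply: le_trans (_ : `|h| * (1 + `|C|) <= e); last exact: ltW.
by rewrite mulrC ler_wpM2l// (le_trans (ler_norm _))// lerDr.
Unshelve. all: by end_near. Qed.

(** The square of the positive part is continuously differentiable, and its
    derivative [2 * max 0 a] is Lipschitz. *)
Lemma max0_sqr_taylor {R : realType} (a b : R) :
  `|Num.max 0 b ^+ 2 - Num.max 0 a ^+ 2 - 2 * Num.max 0 a * (b - a)|
  <= (b - a) ^+ 2.
Proof.
have ab2 := sqr_ge0 (b - a).
rewrite ler_norml; case: (leP 0 a) => a0; case: (leP 0 b) => b0.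
- by apply/andP; split; nra.
- have : 0 <= a * - b by rewrite mulr_ge0// oppr_ge0 ltW.
  by move=> ab; apply/andP; split; nra.
- have : 0 <= b * - a by rewrite mulr_ge0// oppr_ge0 ltW.
  by move=> ab; apply/andP; split; nra.
- by apply/andP; split; nra.
Qed.

Section bump.
Context {R : realType} {n : nat}.
Implicit Types (y : 'rV[R]_n) (i : 'I_n).

(** The simplest radial kernel supported in the unit ball for which the field
    [y |-> bump y *: y] is the gradient of a continuously differentiable
    function, namely [- bump ^+ 2 / 4], with the same support. *)
Definition bump (y : 'rV[R]_n) : R := Num.max 0 (1 - enorm y ^+ 2).

Lemma bump_ge0 y : 0 <= bump y.
Proof. by rewrite /bump le_max lexx. Qed.

Lemma bump_le1 y : bump y <= 1.
Proof. by rewrite /bump ge_max ler01 gerBl sqr_ge0. Qed.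

Lemma bump_eq0 y : 1 <= enorm y -> bump y = 0.
Proof.
by move=> y1; rewrite /bump max_l// subr_le0 exprn_ege1.
Qed.

Lemma continuous_bump : continuous bump.
Proof.
have c1 : continuous (fun y : 'rV[R]_n => 1 - enorm y ^+ 2).
  move=> y.
  apply: (@continuous_atB _ _ (cst 1) (fun y => enorm y ^+ 2) y).
    exact: cst_continuous.
  by apply: continuous_atX; exact: continuous_enorm.
move=> y; apply: (@continuous_max R _ (cst 0) (fun y => 1 - enorm y ^+ 2)).
  exact: cst_continuous.
exact: c1.
Qed.

Lemma continuous_sqr_bump : continuous (fun y => bump y ^+ 2 / 4).
Proof.
move=> y; apply: (@continuous_atM _ _ (fun y => bump y ^+ 2) (cst (4^-1)) y).
  by apply: (@continuous_atX _ _ bump 2 y); exact: continuous_bump.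
exact: cst_continuous.
Qed.

Lemma is_derive_sqr_bump y i :
  is_derive y (delta_mx 0 i) (fun z => bump z ^+ 2 / 4) (- (y 0 i * bump y)).
Proof.
apply: (@is_derive_quadratic _ _ _ _ _ _
  ((2 * `|y 0 i| + 1) ^+ 2 / 4 + bump y / 2)) => h h1.
pose a := 1 - enorm y ^+ 2.
have -> : bump (h *: delta_mx 0 i + y) = Num.max 0 (a - 2 * y 0 i * h - h ^+ 2).
  congr Num.max; rewrite /a !sqr_enorm (bigD1 i)//= [in RHS](bigD1 i)//=.
  rewrite !mxE !eqxx/= mulr1.
  under eq_bigr => j ji.
    rewrite !mxE (negbTE ji) andbF mulr0 add0r.
    over.
  by rewrite /=; ring.
rewrite -/(bump y); set b := a - 2 * y 0 i * h - h ^+ 2.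
have bE : bump y = Num.max 0 a by [].
have := max0_sqr_taylor a b; rewrite -bE; set B := Num.max 0 b.
have -> : b - a = - (2 * y 0 i * h + h ^+ 2) by rewrite /b; ring.
rewrite sqrrN => taylor.
have -> : B ^+ 2 / 4 - bump y ^+ 2 / 4 - h * - (y 0 i * bump y) =
    (B ^+ 2 - bump y ^+ 2 - 2 * bump y * - (2 * y 0 i * h + h ^+ 2)) / 4
    - bump y / 2 * h ^+ 2 by field.
apply: (le_trans (ler_normB _ _)); rewrite [leRHS]mulrDl lerD//.
  rewrite normrM (ger0_norm (x := 4^-1))// [leRHS]mulrAC ler_wpM2r//.
  apply: (le_trans taylor).
  have -> : 2 * y 0 i * h + h ^+ 2 = (2 * y 0 i + h) * h by ring.
  rewrite exprMn ler_wpM2r ?sqr_ge0//.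
  rewrite -[leLHS]real_normK ?num_real// ler_pXn2r ?nnegrE ?addr_ge0 ?mulr_ge0//.
  by rewrite (le_trans (ler_normD _ _))// lerD// normrM ger0_norm.
by rewrite ger0_norm// mulr_ge0 ?sqr_ge0// divr_ge0 ?bump_ge0.
Qed.

Lemma near_enorm_gt y (a : R) : a < enorm y -> \forall z \near y, a < enorm z.
Proof. exact: (cvgr_gt _ (@continuous_enorm R n y)). Qed.

(** The factor [v] is controlled only on the closed unit ball; elsewhere [chi]
    vanishes, and the product is identically zero outside that ball. *)
Lemma continuous_cutoff (chi v : 'rV[R]_n -> R) : continuous chi ->
  (forall y, 1 <= enorm y -> chi y = 0) ->
  (forall y, enorm y <= 1 -> {for y, continuous v}) ->
  continuous (fun y => chi y * v y).
Proof.
move=> cchi chi0 cv y; have [y1|y1] := leP (enorm y) 1.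
  by apply: continuous_atM; [exact: cchi|exact: cv].
have near1 : \forall z \near y, chi z * v z = 0.
  by apply: filterS (near_enorm_gt y1) => z z1; rewrite chi0 ?mul0r// ltW.
exact: (@near_cst_continuous 'rV[R]_n R 0 _ y near1).
Qed.

Lemma is_derive_cutoff (chi chi' v v' : 'rV[R]_n -> R) (e : 'rV[R]_n) y :
  is_derive y e chi (chi' y) ->
  (forall z, 1 <= enorm z -> chi z = 0 /\ chi' z = 0) ->
  (enorm y <= 1 -> is_derive y e v (v' y)) ->
  is_derive y e (fun z => chi z * v z) (chi y * v' y + chi' y * v y).
Proof.
move=> dchi chi0 dv; have [y1|y1] := leP (enorm y) 1.
  have := @is_deriveM _ _ _ _ _ _ _ _ dchi (dv y1).
  by rewrite -[v y *: _]/(v y * chi' y) [v y * _]mulrC.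
have [-> ->] := chi0 _ (ltW y1); rewrite !mul0r addr0.
apply: (@near_eq_is_derive _ _ _ (cst 0)).
apply: filterS (near_enorm_gt y1) => z z1.
by rewrite (chi0 z (ltW z1)).1 mul0r.
Qed.

(** Integration by parts of [v'] against [bump ^+ 2 / 4], whose partial derivatives
    are [- (y 0 i * bump y)]. *)
Lemma integral_bump_partial (v v' : 'rV[R]_n -> R) i :
  (forall y, enorm y <= 1 -> {for y, continuous v}) ->
  (forall y, enorm y <= 1 -> {for y, continuous v'}) ->
  (forall y, enorm y <= 1 -> is_derive y (delta_mx 0 i) v (v' y)) ->
  continuous (fun y => bump y ^+ 2 / 4 * v' y - y 0 i * bump y * v y) /\
  (\int[lebesgue_rV R n]_(y in cube R n)
    (bump y ^+ 2 / 4 * v' y - y 0 i * bump y * v y)%:E = 0)%E.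
Proof.
move=> cv cv' dv.
have csq := continuous_sqr_bump.
have cb : continuous (fun y => y 0 i * bump y).
  move=> y; apply: (@continuous_atM _ _ (fun y : 'rV[R]_n => y 0 i) bump y).
    exact: coord_continuous.
  exact: continuous_bump.
have cg : continuous (fun y => bump y ^+ 2 / 4 * v' y - y 0 i * bump y * v y).
  move=> y; apply: (@continuous_atB _ _ (fun y => bump y ^+ 2 / 4 * v' y)
    (fun y => y 0 i * bump y * v y) y).
    apply: (continuous_cutoff (chi := fun y => bump y ^+ 2 / 4)) => // z z1.
    by rewrite bump_eq0// expr0n mul0r.
  apply: (continuous_cutoff (chi := fun y => y 0 i * bump y)) => // z z1.
  by rewrite bump_eq0// mulr0.
split => //; apply: (integral_cube_partial (i := i)
    (f := fun y => bump y ^+ 2 / 4 * v y)) => // y.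
  rewrite -mulNr; apply: (@is_derive_cutoff (fun y => bump y ^+ 2 / 4)
    (fun y => - (y 0 i * bump y)) v v').
  - exact: is_derive_sqr_bump.
  - by move=> z z1; rewrite bump_eq0// expr0n mul0r mulr0 oppr0.
move=> y1; rewrite bump_eq0 ?expr0n ?mul0r//.
by rewrite -y1 normr_coord_le.
Qed.

End bump.

(** * Monotonicity of weighted averages *)

Section mean_value.
Context {R : realType} {n : nat}.
Variables (Omega : set 'rV[R]_n) (w : 'rV[R]_n -> R) (x : 'rV[R]_n) (d : R).
Hypotheses (openO : open Omega) (smoothw : smooth_on Omega w).
Hypothesis laplw : forall z, Omega z -> 0 <= laplacian w z.
Hypothesis ballO : [set z | enorm (z - x) <= d] `<=` Omega.
Local Notation mu := (lebesgue_rV R n).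

Let affO (t : R) (y : 'rV[R]_n) : `|t| <= d -> enorm y <= 1 -> Omega (x + t *: y).
Proof.
move=> td y1; apply: ballO => /=; rewrite [x + _]addrC addrK enormZ.
by rewrite (le_trans _ td)// ler_piMr.
Qed.

Let continuous_aff (g : 'rV[R]_n -> R) (t : R) : `|t| <= d ->
  (forall z, Omega z -> {for z, continuous g}) ->
  forall y, enorm y <= 1 ->
    {for y, continuous (fun y : 'rV[R]_n => g (x + t *: y))}.
Proof.
move=> td cg y y1.
apply: (@continuous_comp _ _ _ (fun y : 'rV[R]_n => x + t *: y) g).
  exact: continuous_affine.
by apply: cg; exact: affO.
Qed.

Let continuous_bump_aff (g : 'rV[R]_n -> R) (t : R) : `|t| <= d ->
  (forall z, Omega z -> {for z, continuous g}) ->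
  continuous (fun y : 'rV[R]_n => bump y * g (x + t *: y)).
Proof.
move=> td cg.
apply: (continuous_cutoff (chi := bump) (v := fun y : 'rV[R]_n => g (x + t *: y))).
- exact: continuous_bump.
- exact: bump_eq0.
- exact: continuous_aff.
Qed.

Let continuous_w z : Omega z -> {for z, continuous w}.
Proof. by move=> Oz; have [] := smoothw [::] Oz. Qed.

(** The average of [w] over the ball of centre [x] and radius [t], weighted by the
    rescaled kernel and not normalized. *)
Definition bump_avg (t : R) : R :=
  \int[mu]_(y in cube R n) (bump y * w (x + t *: y)).

Let dir (t : R) (y : 'rV[R]_n) := \sum_(i < n) y 0 i * partial i w (x + t *: y).

Let is_derive_ray (t : R) (y : 'rV[R]_n) : `|t| <= d ->
  is_derive t 1 (fun t : R => bump y * w (x + t *: y)) (bump y * dir t y).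
Proof.
move=> td; have [y1|y1] := leP (enorm y) 1; last first.
  rewrite (bump_eq0 (ltW y1)) mul0r.
  rewrite (_ : (fun _ => _) = cst 0); first exact: is_derive_cst.
  by apply/funext => s; rewrite mul0r.
have dray : is_derive t 1 (w \o (fun t : R => x + t *: y)) (dir t y).
  apply: (is_derive_line (U := R) (V := 'rV[R]_n) (f := w)
    (phi := fun t : R => x + t *: y) (v := y)).
    by move=> h; rewrite scalerDl [h *: 1]mulr1 addrCA.
  exact: smooth_on_is_derive openO smoothw (affO td y1).
exact: (@is_deriveZ _ _ _ (w \o (fun t : R => x + t *: y)) (bump y) t 1 (dir t y)).
Qed.

Let integrable_bump (t : R) : `|t| <= d ->
  mu.-integrable (cube R n) (EFin \o (fun y : 'rV[R]_n => bump y * w (x + t *: y))).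
Proof.
by move=> td; apply: continuous_cube_integrable; exact: continuous_bump_aff.
Qed.

Let dir_bound : exists2 M, 0 <= M &
  forall t y, `|t| <= d -> `|bump y * dir t y| <= M.
Proof.
pose G z := \sum_(i < n) `|partial i w z|.
have cG z : Omega z -> {for z, continuous G}.
  move=> Oz; apply: continuous_at_sum => i.
  apply: (@continuous_comp _ _ _ (partial i w) (fun a => `|a|)).
    by have [] := smoothw [:: i] Oz.
  exact: norm_continuous.
have : compact (G @` [set z | enorm (z - x) <= d]).
  apply: continuous_compact; last exact: compact_cball.
  by apply: continuous_in_subspaceT => z /set_mem /ballO; exact: cG.
move=> /compact_bounded[M [_ GM]].
have M1 : 0 <= `|M| + 1 by rewrite addr_ge0.
exists (`|M| + 1) => //.
move=> t y td; have [y1|y1] := leP (enorm y) 1; last first.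
  by rewrite (bump_eq0 (ltW y1)) mul0r normr0.
have Gle : G (x + t *: y) <= `|M| + 1.
  apply: (le_trans (ler_norm _)); apply: GM.
    by rewrite (le_lt_trans (ler_norm _))// ltrDl.
  exists (x + t *: y) => //=; rewrite [x + _]addrC addrK enormZ.
  by rewrite (le_trans _ td)// ler_piMr.
apply: le_trans Gle; rewrite normrM -[leRHS]mul1r ler_pM//.
  by rewrite ger0_norm ?bump_ge0 ?bump_le1.
apply: le_trans (ler_norm_sum _ _ _) _; apply: ler_sum => i _.
by rewrite normrM ler_piMl// (le_trans (normr_coord_le _ _)).
Qed.

(** Differentiation under the integral sign: [dir_bound] supplies a constant
    dominating function, obtained by compactness of the closed ball. *)
Let is_derive_bump_avg (t : R) : `|t| < d ->
  is_derive t 1 bump_avg (\int[mu]_(y in cube R n) (bump y * dir t y)).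
Proof.
move=> td.
have [M M0 dirM] := dir_bound.
have itv_le (s : R) : s \in `](- d), d[ -> `|s| <= d.
  by rewrite in_itv/= -ltr_norml => /ltW.
have It : t \in `](- d), d[ by rewrite in_itv/= -ltr_norml.
have intM : mu.-integrable (cube R n) (EFin \o cst M).
  by apply: continuous_cube_integrable; exact: cst_continuous.
pose f (s : R) (y : 'rV[R]_n) := bump y * w (x + s *: y).
have derE s y : s \in `](- d), d[ -> partial1of2 f s y = bump y * dir s y.
  by move=> sd; rewrite partial1of2E; have [_] := is_derive_ray y (itv_le _ sd).
have intf s : s \in `](- d), d[ -> mu.-integrable (cube R n) (EFin \o f s).
  by move=> sd; exact: integrable_bump (itv_le _ sd).
have derf s y : s \in `](- d), d[ -> cube R n y -> derivable (f ^~ y) s 1.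
  by move=> sd _; have [] := is_derive_ray y (itv_le _ sd).
have ubf s y : s \in `](- d), d[ -> cube R n y -> `|partial1of2 f s y| <= M.
  by move=> sd _; rewrite derE// dirM// itv_le.
have mQ := @measurable_cube R n.
apply: DeriveDef.
  exact: (derivable_under_integral mQ It intf derf (fun=> M0) intM ubf).
rewrite -derive1E.
rewrite [LHS](differentiation_under_integral mQ It intf derf (fun=> M0)
  intM ubf).
by apply: eq_Rintegral => y _; rewrite derE.
Qed.

(** Here subharmonicity enters. Summing the integrations by parts over the
    coordinates replaces [bump y * dir t y] under the integral by
    [t * bump y ^+ 2 / 4 * laplacian w (x + t *: y)], which is nonnegative. *)
Let integral_dir_ge0 (t : R) : 0 <= t <= d ->
  0 <= \int[mu]_(y in cube R n) (bump y * dir t y).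
Proof.
move=> /andP[t0 td].
have td' : `|t| <= d by rewrite ger0_norm.
pose v i (y : 'rV[R]_n) := partial i w (x + t *: y).
pose v' i (y : 'rV[R]_n) := t * partials [:: i; i] w (x + t *: y).
pose g i y := bump y ^+ 2 / 4 * v' i y - y 0 i * bump y * v i y.
have [cg intg] : (forall i, continuous (g i)) /\
    (forall i, \int[mu]_(y in cube R n) (g i y)%:E = 0)%E.
  suff H i : continuous (g i) /\ (\int[mu]_(y in cube R n) (g i y)%:E = 0)%E.
    by split => i; have [] := H i.
  apply: integral_bump_partial => y y1.
  - apply: (continuous_aff td') => // z Oz.
    by have [] := smoothw [:: i] Oz.
  - apply: (@continuous_atM _ _ (cst t)); first exact: cst_continuous.
    apply: (@continuous_aff (partials [:: i; i] w) t td') => // z Oz.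
    by have [] := smoothw [:: i; i] Oz.
  - have := smooth_on_is_derive (t *: delta_mx 0 i) openO
      (smooth_on_partials [:: i] smoothw) (affO td' y1).
    rewrite (bigD1 i)//= !mxE !eqxx/= mulr1 big1 ?addr0 => [dw|j ji]; last first.
      by rewrite !mxE (negbTE ji) andbF mulr0 mul0r.
    apply: (is_derive_line (U := 'rV[R]_n) (V := 'rV[R]_n) (f := partial i w)
      (phi := fun y : 'rV[R]_n => x + t *: y) (v := t *: delta_mx 0 i)).
    by move=> h; rewrite scalerDr !scalerA mulrC addrCA.
(* [A] is what [bump y * dir t y] becomes after integration by parts, and the
   [g i] are the corresponding exact derivatives. *)
pose A y := bump y ^+ 2 / 4 * (t * laplacian w (x + t *: y)).
have cA : continuous A.
  apply: (continuous_cutoff (chi := fun y : 'rV[R]_n => bump y ^+ 2 / 4)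
    (v := fun y : 'rV[R]_n => t * laplacian w (x + t *: y))).
  - exact: continuous_sqr_bump.
  - by move=> y y1; rewrite bump_eq0// expr0n mul0r.
  - move=> y y1.
    apply: (@continuous_atM _ _ (cst t)); first exact: cst_continuous.
    apply: (@continuous_aff (laplacian w) t td') => // z Oz.
    by have [] := smooth_on_laplacian openO smoothw [::] Oz.
have cG : continuous (fun y => \sum_(i < n) g i y).
  by move=> y; apply: continuous_at_sum => i; exact: cg.
have mQ := @measurable_cube R n.
have -> : \int[mu]_(y in cube R n) (bump y * dir t y) =
    \int[mu]_(y in cube R n) (A y - \sum_(i < n) g i y).
  apply: eq_Rintegral => y _.
  rewrite /A /laplacian /dir !mulr_sumr -sumrB; apply: eq_bigr => i _.
  by rewrite /g /v /v'; ring.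
rewrite RintegralB//; [|exact: continuous_cube_integrable..].
have -> : \int[mu]_(y in cube R n) (\sum_(i < n) g i y) = 0.
  rewrite /Rintegral; under eq_integral do rewrite -sumEFin.
  rewrite integral_sum//; last by move=> i; exact: continuous_cube_integrable.
  by rewrite big1.
rewrite subr0; apply: Rintegral_ge0 => y _; rewrite /A.
have [y1|y1] := leP (enorm y) 1; last first.
  by rewrite (bump_eq0 (ltW y1)) expr0n/= !mul0r.
rewrite mulr_ge0 ?divr_ge0 ?sqr_ge0// mulr_ge0//.
by apply: laplw; exact: affO.
Qed.

(** The weighted average is nondecreasing in the radius, and at radius [0] it is
    [w x] times the mass of the kernel. *)
Lemma bump_avg_le t : 0 <= t < d ->
  w x * \int[mu]_(y in cube R n) bump y <= bump_avg t.
Proof.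
move=> /andP[t0 td].
have -> : w x * \int[mu]_(y in cube R n) bump y = bump_avg 0.
  rewrite -RintegralZl//; first last.
  - by apply: continuous_cube_integrable; exact: continuous_bump.
  - exact: measurable_cube.
  by apply: eq_Rintegral => y _; rewrite scale0r addr0 mulrC.
have normd (s : R) : 0 <= s <= t -> `|s| < d.
  by move=> /andP[s0 st]; rewrite ger0_norm// (le_lt_trans st).
apply: (@ger0_derive1_ndecr R bump_avg 0 t) => //.
- move=> s /subset_itv_oo_cc; rewrite in_itv/= => st.
  by have [] := is_derive_bump_avg (normd s st).
- move=> s /subset_itv_oo_cc; rewrite in_itv/= => st.
  rewrite derive1E; have [_ ->] := is_derive_bump_avg (normd s st).
  apply: integral_dir_ge0; case/andP: st => -> /= st.
  by rewrite (le_trans st)// ltW.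
- apply: derivable_within_continuous => s; rewrite in_itv/= => st.
  by have [] := is_derive_bump_avg (normd s st).
Qed.

End mean_value.

(** * Norms of the kernel and scaling *)

Section bump_integrals.
Context {R : realType} {n : nat}.
Local Notation mu := (lebesgue_rV R n).

Lemma bump_cube (y : 'rV[R]_n) : ~ cube R n y -> bump y = 0.
Proof.
apply: contra_notP => /eqP b0 i; rewrite /= in_itv/= -ler_norml.
apply: le_trans (normr_coord_le y i) _; rewrite leNgt; apply/negP => y1.
by move: b0; rewrite bump_eq0 ?eqxx// ltW.
Qed.

Lemma measurable_EFin_bump (A : set 'rV[R]_n) :
  measurable_fun A (fun y => (bump y)%:E).
Proof.
apply/measurable_EFinP; apply: measurable_funTS.
by apply: continuous_measurable_rV; exact: continuous_bump.
Qed.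

(** The kernel is at least [1 / 2] on the cube of half-side [1 / (n + 2)], because
    [n / (n + 2) ^ 2 <= 1 / 2]. *)
Lemma integral_bump_gt0 : 0 < \int[mu]_(y in cube R n) bump y.
Proof.
pose s : R := (n.+2)%:R^-1.
have s0 : 0 < s by rewrite invr_gt0.
have s1 : s <= 1 by rewrite invf_le1 ?ler1n.
pose A := [set y : 'rV[R]_n | forall i, `[- s, s]%classic (y 0 i)].
have mA : measurable A.
  by apply: (@measurable_rV_box R n (fun=> `[- s, s]%classic)) => i.
have muA : mu A = ((s + s) ^+ n)%:E.
  rewrite /A (@lebesgue_rV_box R n (fun=> `[- s, s]%classic))//.
  under eq_bigr do rewrite lebesgue_measure_itv/= lte_fin gtrN// -EFinD opprK.
  by rewrite prodEFin prodr_const card_ord.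
have AQ : A `<=` cube R n.
  move=> y Ay i; have := Ay i; rewrite /= !in_itv/= => /andP[sy ys].
  by rewrite (le_trans _ sy) ?lerN2// (le_trans ys).
have bumpA y : A y -> 2^-1 <= bump y.
  move=> Ay; rewrite /bump le_max; apply/orP; right.
  rewrite lerBrDr -lerBrDl.
  have -> : (1 - 2^-1 : R) = 2^-1 by field.
  rewrite sqr_enorm.
  apply: (@le_trans _ _ (\sum_(i < n) s ^+ 2)).
    apply: ler_sum => i _; have := Ay i; rewrite /= in_itv/= -ler_norml => ys.
    by rewrite -real_normK ?num_real// ler_pXn2r ?nnegrE// ltW.
  rewrite sumr_const card_ord -[_ *+ n]mulr_natr /s exprVn.
  rewrite -ler_pdivlMl ?invr_gt0 ?exprn_gt0//.
  rewrite invrK -natrX ler_pdivlMr// -natrM ler_nat mulnC expnS expn1.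
  by rewrite leq_mul// !leqW.
rewrite /Rintegral fine_gt0//; apply/andP; split; last first.
  have := integrable_fin_num (@measurable_cube R n)
    (continuous_cube_integrable (@continuous_bump R n)).
  by rewrite fin_numElt => /andP[].
apply: (@lt_le_trans _ _ (\int[mu]_(y in A) (2^-1)%:E)%E).
  rewrite integral_cst// [X in (_ * X)%E]muA -EFinM lte_fin.
  by rewrite mulr_gt0// exprn_gt0// addr_gt0.
apply: (@le_trans _ _ (\int[mu]_(y in A) (bump y)%:E)%E).
  apply: ge0_le_integral => //.
  exact: measurable_EFin_bump.
apply: ge0_subset_integral => //.
- exact: measurable_cube.
- exact: measurable_EFin_bump.
- by move=> y _; rewrite lee_fin bump_ge0.
Qed.

(** The kernel is bounded by the indicator function of the cube. *)
Lemma Lnorm_bump_lty (q : R) : 0 < q ->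
  ('N[mu]_q%:E[EFin \o bump] < +oo)%E.
Proof.
move=> q0; rewrite unlock; apply: poweR_lty.
apply: (@le_lt_trans _ _ (\int[mu]_(y in cube R n) (cst 1%E y))%E); last first.
  by rewrite integral_cst ?mul1e ?lebesgue_cube_lty//; exact: measurable_cube.
rewrite [leRHS]integral_mkcond; apply: ge0_le_integral => //.
- by move=> y _; exact: poweR_ge0.
- apply: (measurableT_comp (measurable_poweR q)).
  by apply: measurableT_comp => //; exact: measurable_EFin_bump.
- apply/(measurable_restrictT _ _).1 => //; exact: measurable_cube.
- move=> y _; rewrite patchE; case: ifPn => [_|].
    rewrite /= ger0_norm ?bump_ge0// lee_fin.
    apply: le_trans (_ : 1 `^ q <= 1); last by rewrite powR1.
    by apply: ge0_ler_powR; rewrite ?nnegrE ?bump_ge0 ?bump_le1// ltW.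
  rewrite notin_setE => /bump_cube /= ->; rewrite normr0 powR0//.
  by rewrite gt_eqF.
Qed.

Lemma Lnorm_affine (g : 'rV[R]_n -> R) (x : 'rV[R]_n) (d q : R) :
  0 < d -> 0 < q -> measurable_fun setT g ->
  ('N[mu]_q%:E[EFin \o (fun y : 'rV[R]_n => g (x + d *: y)%R)] =
   ((d ^- n) `^ q^-1)%R%:E * 'N[mu]_q%:E[EFin \o g])%E.
Proof.
move=> d0 q0 mg; rewrite unlock.
have mgq : measurable_fun setT (fun y => `|(g y)%:E| `^ q)%E.
  apply: (measurableT_comp (measurable_poweR q)).
  by apply: measurableT_comp => //; exact/measurable_EFinP.
rewrite -poweR_EFin -poweRM//; last 2 first.
  by rewrite lee_fin invr_ge0 exprn_ge0// ltW.
  by apply: integral_ge0 => y _; exact: poweR_ge0.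
congr (_ `^ _)%E.
rewrite -(ge0_integral_rV_affine x d0 mgq); last by move=> y; exact: poweR_ge0.
by rewrite muleA -EFinM mulVf ?mul1e// expf_neq0// gt_eqF.
Qed.

End bump_integrals.

(** * The local bound for subharmonic functions *)

Section subharmonic.
Context {R : realType} {n : nat}.
Local Notation mu := (lebesgue_rV R n).

(** The mean-value inequality at radius [d], followed by Hoelder with exponents
    [(1 - q^-1)^-1] and [q] and the substitution [z = x + d *: y]. *)
Lemma subharmonic_Lnorm_bound (q : R) (Omega : set 'rV[R]_n)
    (w : 'rV[R]_n -> R) (c x : 'rV[R]_n) (rho d : R) :
  1 < q -> open Omega -> smooth_on Omega w ->
  (forall z, Omega z -> 0 <= w z) ->
  (forall z, Omega z -> 0 <= laplacian w z) ->
  0 < d -> enorm (x - c) + d < rho -> eball c rho `<=` Omega ->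
  ((w x * \int[mu]_(y in cube R n) bump y)%:E <=
   'N[mu]_((1 - q^-1)^-1)%:E[EFin \o bump] *
   (((d ^- n) `^ q^-1)%:E * LnormOn q (eball c rho) w))%E.
Proof.
move=> q1 oO sw w0 lw0 d0 xd BO.
have q0 : 0 < q by rewrite (lt_trans _ q1).
have qV1 : q^-1 < 1 by rewrite invf_lt1.
(* The average must be differentiable up to radius [d] included, so the
   mean-value inequality is used on a slightly larger closed ball. *)
pose D := d + (rho - d - enorm (x - c)) / 2.
have dD : 0 <= d < D by rewrite /D ltW//=; lra.
have ballO : [set z | enorm (z - x) <= D] `<=` Omega.
  move=> z /= zx; apply: BO; rewrite /eball/=.
  rewrite (_ : z - c = (z - x) + (x - c)); last by rewrite addrA subrK.
  by apply: le_lt_trans (enormD _ _) _; rewrite /D in zx; lra.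
have := bump_avg_le oO sw lw0 ballO dD.
rewrite -lee_fin => /le_trans; apply.
pose B := eball c rho.
have cw z : Omega z -> {for z, continuous w} by move=> Oz; have [] := sw [::] z Oz.
have mw : measurable_fun setT (w \_ B).
  have mB : measurable B by apply: open_measurable_rV; exact: open_eball.
  apply: (measurable_restrictT _ mB).1.
  apply: open_continuous_measurable_rV; first exact: open_eball.
  by move=> z /BO; exact: cw.
pose g (y : 'rV[R]_n) := (w \_ B) (x + d *: y).
(* Only the values of [w] inside the ball of radius [rho] are seen by the kernel,
   so [w] may be replaced by its restriction, which is measurable. *)
have bumpg y : bump y * w (x + d *: y) = `|bump y * g y|.
  have [y1|y1] := leP 1 (enorm y); first by rewrite bump_eq0// !mul0r normr0.
  have By : B (x + d *: y).
    rewrite /B /eball/= (_ : _ - c = (x - c) + d *: y); last by rewrite addrAC.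
    apply: le_lt_trans (enormD _ _) (lt_trans _ xd).
    by rewrite ltrD2l enormZ gtr0_norm// gtr_pMr.
  by rewrite /g patchE mem_set// ger0_norm// mulr_ge0 ?bump_ge0// w0//; exact: BO.
have -> : ((bump_avg w x d)%:E = 'N[mu]_1[EFin \o (bump \* g)%R])%E.
  rewrite Lnorm1 /bump_avg /Rintegral fineK; last first.
    apply: integrable_fin_num; first exact: measurable_cube.
    apply: continuous_cube_integrable.
    apply: (continuous_cutoff (chi := bump)
      (v := fun y : 'rV[R]_n => w (x + d *: y))).
    - exact: continuous_bump.
    - exact: bump_eq0.
    - move=> y y1.
      apply: (@continuous_comp _ _ _ (fun y : 'rV[R]_n => x + d *: y) w).
        exact: continuous_affine.
      apply: cw; apply: ballO => /=; rewrite [x + _]addrC addrK enormZ gtr0_norm//.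
      by case/andP: dD => _ /ltW; apply: le_trans; rewrite ler_piMr// ltW.
  rewrite integral_mkcond; apply: eq_integral => y _; rewrite patchE /=.
  case: ifPn => [_|]; first by rewrite bumpg.
  by rewrite notin_setE => /bump_cube ->; rewrite mul0r normr0.
apply: (@le_trans _ _ ('N[mu]_((1 - q^-1)^-1)%:E[EFin \o bump] *
    'N[mu]_q%:E[EFin \o g])%E).
  apply: hoelder => //.
  - by apply: continuous_measurable_rV; exact: continuous_bump.
  - exact: (measurableT_comp mw (measurable_rV_affine x d)).
  - by rewrite invr_gt0 subr_gt0.
  - by rewrite invrK subrK.
by rewrite (Lnorm_affine x d0 q0 mw) /LnormOn restrict_EFin.
Qed.

End subharmonic.

Lemma sqr_scaling_factor {R : realType} (n : nat) (p d : R) : 0 < p -> 0 < d ->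
  ((d ^- n) `^ (2 * p)^-1) ^+ 2 = (d `^ (n%:R / p))^-1.
Proof.
move=> p0 d0; rewrite -powR_invn ?ltW// -powRrM -powR_mulrn ?powR_ge0//.
rewrite -powRrM -powRN; congr (_ `^ _).
by field; rewrite gt_eqF.
Qed.

Theorem proposition6p3 (R : realType) (n : nat) (p : R) (hp : 1 <= p) :
  exists2 C : R, 0 < C &
  forall (Omega : set 'rV[R]_n) (u : 'rV[R]_n -> R)
    (F : 'rV[R]_n -> R -> 'rV[R]_n -> 'M[R]_n ->
         ('I_n -> 'I_n -> 'I_n -> R) -> R),
    open Omega ->
    smooth_on Omega u ->
    convex_on Omega u ->
    (forall x z v A T, Omega x -> 0 <= F x z v A T) ->
    (forall x, Omega x ->
       F x (u x) (gradient u x) (hessian u x) (third_derivative u x)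
         <= bilaplacian u x) ->
    forall (c : 'rV[R]_n) (r rho : R),
      0 < r -> r < rho -> eball c rho `<=` Omega ->
      (ereal_sup [set (laplacian u x ^+ 2)%:E | x in eball c r] <=
       (C / (rho - r) `^ (n%:R / p))%:E *
         LnormOn (2 * p) (eball c rho) (laplacian u) ^+ 2)%E.
Proof.
have p0 : 0 < p by rewrite (lt_le_trans _ hp).
have q1 : 1 < 2 * p by lra.
have q'0 : 0 < (1 - (2 * p)^-1)^-1.
  by rewrite invr_gt0 subr_gt0 invf_lt1// (lt_trans _ q1).
set q' := (1 - (2 * p)^-1)^-1 in q'0.
pose I0 := \int[lebesgue_rV R n]_(y in cube R n) bump y.
have I00 : 0 < I0 by exact: integral_bump_gt0.
pose K := fine ('N[lebesgue_rV R n]_q'%:E[EFin \o @bump R n])%E.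
have K0 : 0 <= K by apply: fine_ge0; exact: Lnorm_ge0.
have KE : ('N[lebesgue_rV R n]_q'%:E[EFin \o @bump R n])%E = K%:E.
  by rewrite fineK// ge0_fin_numE ?Lnorm_ge0// Lnorm_bump_lty.
(* The proof gives the constant [(K / I0) ^+ 2]; adding [1] makes it positive
   without computing [K]. *)
exists ((K / I0) ^+ 2 + 1); first by rewrite ltr_wpDl ?sqr_ge0.
move=> Omega u F oO su cu F0 uF c r rho r0 rrho BO.
set w := laplacian u; set N := LnormOn _ _ _.
have sw : smooth_on Omega w by exact: smooth_on_laplacian.
have w0 z : Omega z -> 0 <= w z.
  by move=> Oz; exact: (@convex_on_laplacian_ge0 _ _ Omega).
have lw0 z : Omega z -> 0 <= laplacian w z.
  by move=> Oz; apply: le_trans (uF z Oz); exact: F0.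
set d := rho - r; have d0 : 0 < d by rewrite subr_gt0.
set E := d `^ (n%:R / p); have E0 : 0 < E by exact: powR_gt0.
apply: ge_ereal_sup => _ [x xr <-].
have xd : enorm (x - c) + d < rho by rewrite /d; move: xr; rewrite /eball/=; lra.
have w0x : 0 <= w x.
  by apply: w0; apply: BO; rewrite /eball/= (lt_trans _ rrho).
have := subharmonic_Lnorm_bound q1 oO sw w0 lw0 d0 xd BO.
rewrite -/q' KE -/I0 -/N; set e := (_ `^ (2 * p)^-1).
have e0 : 0 <= e by exact: powR_ge0.
have e2 : e ^+ 2 = E^-1 by exact: sqr_scaling_factor.
have : (0 <= N)%E by exact: Lnorm_ge0.
(* The norm may be infinite, since [w] need not be bounded near the sphere. *)
clearbody N; case: N => [m| |] //.
- rewrite lee_fin => m0 bound.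
  rewrite -EFin_expe -EFinM lee_fin.
  have wle : w x <= K / I0 * (e * m).
    by rewrite mulrAC ler_pdivlMr.
  apply: le_trans (_ : (K / I0 * (e * m)) ^+ 2 <= _).
    by rewrite ler_pXn2r ?nnegrE// !mulr_ge0// invr_ge0 ltW.
  rewrite exprMn (exprMn _ e) e2 mulrA ler_wpM2r ?sqr_ge0//.
  by rewrite ler_wpM2r ?invr_ge0 ?(ltW E0)// lerDl.
- move=> _ _; rewrite expe2 mulyy gt0_muley ?leey//.
  by rewrite lte_fin divr_gt0// ltr_wpDl ?sqr_ge0.
Qed.
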